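(* Let $k\in\mathbb{N}$. The following hold, where the asymptotic notation refers to $n\to\infty$, $n\in\mathbb{N}$. (1) For every $k\ge 6$, $$\mathsf{s}_{kn}(C_n^3)=(k+3)n+O\left(\frac{n}{\ln n}\right).$$ (2) For every $k\ge 18$, $$\mathsf{s}_{kn}(C_n^4)=(k+4)n+O\left(\frac{n}{\ln n}\right).$$ (3) For every $k\in\mathbb{N}$ and every fixed integer $r\ge 5$, $$\mathsf{s}_{k\mathsf{p}(n,r)n}(C_n^r)=(k\,\mathsf{p}(n,r)+r)n+O_r\left(\frac{n}{\ln n}\right),$$ where the implied constant in $O_r$ depends on $r$.
   Context: $\mathbb{N}$ denotes the positive integers. $C_n$ is the cyclic group of order $n$ and $C_n^r$ is the direct sum of $r$ copies of it (exponent $n$). A sequence over a finite abelian group $G$ is a finite unordered sequence of elements of $G$ with repetition allowed; its length is the number of terms counted with multiplicity, a subsequence is a sub-multiset, and a sequence is zero-sum if its terms sum to $0$. For a finite abelian group $G$ with exponent $m$ and $k\in\mathbb{N}$, $\mathsf{s}_{km}(G)$ is the smallest positive integer $t$ such that every sequence over $G$ of length at least $t$ has a zero-sum subsequence of length exactly $km$. Thus $\mathsf{s}_{kn}(C_n^r)$ refers to zero-sum subsequences of length $kn$. For $n\ge 2$, $\mathsf{M}(n)=\max\{p^j : p \text{ prime},\ j\in\mathbb{N},\ p^j\mid n\}$ is the largest prime power divisor of $n$. If $\mathsf{M}(n)=p^a$ with $p$ prime, then $\mathsf{p}(n,r)=\min\{p^t : t\in\mathbb{N},\ p^t\ge r\}$,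 the smallest power (with positive exponent) of that prime $p$ which is at least $r$. $f(x)=O(g(x))$ means there exist a real $M>0$ and a positive integer $x_0$ such that $|f(x)|\le M|g(x)|$ for all $x\ge x_0$; a subscript on $O$ lists the parameters on which $M$ depends ($M$ is absolute if there is no subscript), while $x_0$ may depend on the fixed parameters. *)

(* Defs.v *)
From HB Require Import structures.
From mathcomp Require Import all_boot all_order all_algebra.
From mathcomp Require Import boolp classical_sets reals exp.

Set Implicit Arguments.
Unset Strict Implicit.
Unset Printing Implicit Defensive.

Import Order.TTheory GRing.Theory Num.Theory.
Local Open Scope classical_set_scope.
Local Open Scope ring_scope.

(* Junk value 0 if A is empty. *)
Definition least (A : set nat) : nat :=
  xget 0%N [set m : nat | A m /\ forall m', A m' -> (m <= m')%N].

Lemma leastP (A : set nat) (m : nat) :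
  A m -> A (least A) /\ forall m', A m' -> (least A <= m')%N.
Proof.
move=> Am; rewrite /least.
have exA : exists i, `[< A i >] by exists m; apply/asboolP.
case: (ex_minnP exA) => l /asboolP Al minl.
have Ll : [set m : nat | A m /\ forall m', A m' -> (m <= m')%N] l.
  by split=> // m' Am'; apply: minl; apply/asboolP.
exact: (xgetI 0%N Ll).
Qed.

(* Unordered sequences are represented by lists, all notions used being
   invariant under permutation; T is a sub-multiset of S. *)
Definition submultiset (G : eqType) (T S : seq G) : Prop :=
  forall x, (count_mem x T <= count_mem x S)%N.

Definition has_zero_sum_subseq (G : finZmodType) (L : nat) (S : seq G) : Prop :=
  exists T : seq G, [/\ submultiset T S, size T = L & \sum_(x <- T) x = 0].

(* s_L(G); the minimum exists whenever the exponent of G divides L, see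
   s_invP. *)
Definition s_inv (G : finZmodType) (L : nat) : nat :=
  least [set t : nat | (0 < t)%N /\
           forall S : seq G, (t <= size S)%N -> has_zero_sum_subseq L S].

Lemma s_invP (G : finZmodType) (L : nat) : (forall g : G, g *+ L = 0) ->
  [/\ (0 < s_inv G L)%N,
      forall S : seq G, (s_inv G L <= size S)%N -> has_zero_sum_subseq L S
    & forall t, (0 < t)%N ->
        (forall S : seq G, (t <= size S)%N -> has_zero_sum_subseq L S) ->
        (s_inv G L <= t)%N].
Proof.
move=> GL.
have [] := @leastP [set t : nat | (0 < t)%N /\
  forall S : seq G, (t <= size S)%N -> has_zero_sum_subseq L S] (#|G| * L).+1.
  split=> // S ltS.
  have [x Lx] : exists x : G, (L <= count_mem x S)%N.
    apply/existsP; apply: contraLR ltS; rewrite -leqNgt => /existsPn Sx.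
    have -> : size S = (\sum_(x : G) count_mem x S)%N.
      elim: (S) => [|y s IHs] /=; first by rewrite big1.
      rewrite big_split /= -IHs (bigD1 y) //= eqxx big1 ?addn0 // => i.
      by rewrite eq_sym => /negPf ->.
    rewrite -sum_nat_const; apply: leq_sum => x _.
    by apply: ltnW; rewrite ltnNge.
  exists (nseq L x); split; last 2 first.
  - exact: size_nseq.
  - by rewrite big_nseq -Monoid.iteropE -/(GRing.natmul x L) GL.
  move=> y; rewrite count_nseq /=; case: eqP => [<-|_]; last by rewrite mul0n.
  by rewrite mul1n.
by move=> [s0 sP] smin; split=> // t t0 tP; apply: smin.
Qed.

(* C_n^r for n > 0: 'I_m.+1 carries addition modulo m.+1.  The ring 'Z_n is
   avoided because 'Z_1 has two elements. *)
Definition Cpow (n r : nat) : finZmodType := 'rV['I_n.-1.+1]_r.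

Lemma card_Cpow (n r : nat) : (0 < n)%N -> #|Cpow n r| = (n ^ r)%N.
Proof. by case: n => // n _; rewrite /Cpow card_mx card_ord mul1n. Qed.

Lemma Cpow_mulrn (n r k : nat) (g : Cpow n r) : (0 < n)%N -> g *+ (k * n) = 0.
Proof.
case: n g => // n g _; apply/rowP => i; rewrite mxE; apply: val_inj.
by rewrite mulmxnE /= Zp_mulrn /= mulnA modnMl.
Qed.

(* Largest prime power divisor of n >= 2; the bounds on p and j are harmless
   since p ^ j %| n forces p <= n and j <= n. *)
Definition max_ppow (n : nat) : nat :=
  \max_(p < n.+1 | prime p) \max_(1 <= j < n.+1 | (p ^ j %| n)%N) (p ^ j)%N.

Lemma max_ppow_ub (n p j : nat) :
  (0 < n)%N -> prime p -> (0 < j)%N -> (p ^ j %| n)%N ->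
  (p ^ j <= max_ppow n)%N.
Proof.
move=> n0 pp j0 pjn.
have pjle := dvdn_leq n0 pjn.
have ltpn : (p < n.+1)%N.
  by rewrite ltnS (leq_trans _ pjle) // -{1}[p]expn1 leq_exp2l // prime_gt1.
have ltjn : (j < n.+1)%N.
  by rewrite ltnS (leq_trans _ pjle) // ltnW // ltn_expl // prime_gt1.
apply: leq_trans (@leq_bigmax_cond _ (fun p : 'I_n.+1 => prime p)
  (fun p => \max_(1 <= j < n.+1 | (p ^ j %| n)%N) (p ^ j)%N) (Ordinal ltpn) pp).
apply: (@leq_bigmax_seq _ _ (fun j => p ^ j %| n)%N (fun j => p ^ j)%N) => //.
by rewrite mem_index_iota j0.
Qed.

Lemma max_ppowP (n : nat) : (1 < n)%N ->
  exists p j, [/\ prime p, (0 < j)%N, (p ^ j %| n)%N & max_ppow n = (p ^ j)%N].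
Proof.
move=> n1.
have M0 : (0 < max_ppow n)%N.
  apply: leq_trans (@max_ppow_ub n (pdiv n) 1 (ltnW n1) (pdiv_prime n1) _ _) => //.
    by rewrite expn1 prime_gt0 // pdiv_prime.
  by rewrite expn1 pdiv_dvd.
pose P m := m = 0%N \/
  exists p j, [/\ prime p, (0 < j)%N, (p ^ j %| n)%N & m = (p ^ j)%N].
have : P (max_ppow n).
  have Pmax x y : P x -> P y -> P (maxn x y) by rewrite /maxn; case: ifP.
  apply: big_ind => [|//|p pp]; [by left | rewrite big_seq_cond].
  apply: big_ind => [|//|j]; first by left.
  rewrite mem_index_iota => /andP[/andP[j0 _] pjn].
  by right; exists p, j.
by case=> // M_eq0; rewrite M_eq0 in M0.
Qed.

(* p(n, r): pdiv (max_ppow n) is the prime of which max_ppow n is a power. *)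
Definition ppow_ge (n r : nat) : nat :=
  let p := pdiv (max_ppow n) in
  least [set q : nat | exists t : nat, [/\ (0 < t)%N, q = (p ^ t)%N & (r <= q)%N]].

Lemma ppow_geE (n r p a : nat) :
  prime p -> (0 < a)%N -> max_ppow n = (p ^ a)%N ->
  (exists t, [/\ (0 < t)%N, ppow_ge n r = (p ^ t)%N & (r <= ppow_ge n r)%N]) /\
  forall t, (0 < t)%N -> (r <= p ^ t)%N -> (ppow_ge n r <= p ^ t)%N.
Proof.
move=> pp a0 Mn.
have -> : ppow_ge n r = least
    [set q : nat | exists t : nat, [/\ (0 < t)%N, q = (p ^ t)%N & (r <= q)%N]].
  by case: a a0 Mn => // a _; rewrite /ppow_ge => ->; rewrite pdiv_pfactor.
have [|exq minq] := @leastP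
    [set q : nat | exists t : nat, [/\ (0 < t)%N, q = (p ^ t)%N & (r <= q)%N]]
    (p ^ r.+1)%N.
  by exists r.+1; split=> //; rewrite ltnW // ltnW // ltn_expl // prime_gt1.
by split=> // t t0 rt; apply: minq; exists t.
Qed.

(* f = O(g) with implied constant M. *)
Definition bigO_with (R : realType) (M : R) (f g : nat -> R) : Prop :=
  exists2 x0 : nat, (0 < x0)%N &
    forall n : nat, (x0 <= n)%N -> `|f n| <= M * `|g n|.

(* Main.v *)
(* Let q = p^a be the largest prime power divisor of n and m = n / q.

   By the Alon-Dubiner theorem, c_r m vectors over C_m^r contain m with sum 0, so
   a sequence of length (k + r) n + c_r m over C_n^r contains (k + r) q disjoint
   subsequences of length m with sums in m C_n^r = C_q^r.  Hence it is enough to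
   find k q of these sums with sum 0, i.e. to show s_{kq}(C_q^r) <= (k + r) q.
   Since n <= 16^q, the excess c_r m is O(n / ln n).  The lower bound comes from
   the sequence 0^(kn-1) e_1^(n-1) ... e_r^(n-1).

   For the p-group C_q^r, polynomial functions of degree less than the length of
   a sequence over F_p detect zero-sum subsequences.  This gives the claim when k
   is a multiple of p^t >= r.  It also shows that any sequence of length L q
   contains zero-sum subsequences of lengths j q with j outside of any prescribed
   set of L - r - 1 numbers prime to p; for r = 3, 4 and p >= 5 a finite case
   analysis then settles small k, and the good k are closed under addition.  For
   p = 2, 3 one splits off subsequences of length q until k is a multiple of p^t;
   these exist by the pigeonhole principle when p = 2 and by bounds on cap sets
   when p = 3.

   Alon-Dubiner is multiplicative in m, so let m = p be prime, and induct on r.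
   If an affine hyperplane contains many terms, one coordinate can be dropped.
   Otherwise, choosing one term from each of p / 2 suitable disjoint pairs, one
   obtains more than half of F_p^r as sums: the set of sums grows like a box up to
   constant density, and by the spectral gap of the Cayley graph afterwards. *)

Require Import Defs.
From mathcomp Require Import all_boot all_order all_algebra.
From mathcomp Require Import boolp reals exp.
From mathcomp Require Import zify ring.
Set Implicit Arguments.
Unset Strict Implicit.
Unset Printing Implicit Defensive.
Import Order.TTheory GRing.Theory Num.Theory.
Local Open Scope ring_scope.

(** * Zero-sum subsequences of prescribed length *)

(** The complement [U] is kept so that further subsequences can be split off; the predicate [Z] lets
    one notion serve for vectors over ['F_p] and for natural vectors modulo n. *)
Definition zsub (V : nmodType) (Z : pred V) (L : nat) (S : seq V) : Prop :=
  exists T U : seq V, [/\ perm_eq S (T ++ U), size T = L & Z (\sum_(x <- T) x)].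

Lemma perm_size_cat (V : nmodType) (S T U : seq V) :
  perm_eq S (T ++ U) -> size S = (size T + size U)%N.
Proof. by move=> /perm_size; rewrite size_cat. Qed.

Definition zall (V : nmodType) (Z : pred V) (L t : nat) : Prop :=
  forall S : seq V, (t <= size S)%N -> zsub Z L S.

Lemma zsub_catl (V : nmodType) (Z : pred V) L (S S1 S2 : seq V) :
  perm_eq S (S1 ++ S2) -> zsub Z L S1 -> zsub Z L S.
Proof.
move=> SS [T [U [S1E sT ZT]]]; exists T, (U ++ S2); split=> //.
by rewrite (perm_trans SS) // catA perm_cat2r.
Qed.

Lemma zall_leq (V : nmodType) (Z : pred V) L t t' :
  (t <= t')%N -> zall Z L t -> zall Z L t'.
Proof. by move=> tt' Zt S tS; apply: Zt; apply: leq_trans tS. Qed.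

Lemma perm_map_lift (T1 T2 : eqType) (f : T1 -> T2) (s : seq T1) (t : seq T2) :
  perm_eq (map f s) t -> exists2 s', perm_eq s s' & map f s' = t.
Proof.
case: s => [|x0 s] /=.
  by rewrite perm_sym => /perm_nilP ->; exists [::].
set s0 := x0 :: s; rewrite perm_sym => /(perm_iotaP (f x0))[Is pI ->].
exists (map (nth x0 s0) Is).
  by rewrite perm_sym; apply/(perm_iotaP x0); exists Is; rewrite // -(size_map f).
rewrite -map_comp; apply/eq_in_map => i /=; rewrite (perm_mem pI) mem_iota /=.
by rewrite add0n size_map => ltis; rewrite (nth_map x0 (f x0) f (s := s0)).
Qed.

Lemma zsub_map (V W : nmodType) (f : V -> W) (Z : pred V) (Z' : pred W) L S :
  (forall s, {subset s <= S} -> size s = L ->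
     Z' (\sum_(x <- map f s) x) -> Z (\sum_(x <- s) x)) ->
  zsub Z' L (map f S) -> zsub Z L S.
Proof.
move=> ZZ [T [U [pS sT ZT]]].
have [S' pS' S'E] := perm_map_lift pS.
have sT' : (size T <= size S')%N by rewrite -(size_map f S') S'E size_cat leq_addr.
have TE : map f (take (size T) S') = T by rewrite map_take S'E take_size_cat.
exists (take (size T) S'), (drop (size T) S'); split.
- by rewrite cat_take_drop.
- by rewrite size_take_min (minn_idPl sT').
- apply: ZZ; rewrite ?TE ?size_take_min ?(minn_idPl sT') //.
  by move=> x /mem_take; rewrite (perm_mem pS').
Qed.

(** Removing the first subsequence leaves at least [L2 + c] terms, so the excess [c] does not
    accumulate. *)
Lemma zall_cat (V : nmodType) (Z : pred V) L1 L2 c :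
  (forall x y, Z x -> Z y -> Z (x + y)) ->
  zall Z L1 (L1 + c) -> zall Z L2 (L2 + c) -> zall Z (L1 + L2) (L1 + L2 + c).
Proof.
move=> ZD Z1 Z2 S tS.
have [|T1 [U1 [p1 s1 z1]]] := Z1 S; first by move: tS; lia.
have sz := perm_size_cat p1.
have [|T2 [U2 [p2 s2 z2]]] := Z2 U1; first by move: tS sz; lia.
exists (T1 ++ T2), U2; split.
- by rewrite (perm_trans p1) // -catA perm_cat2l.
- by rewrite size_cat s1 s2.
- by rewrite big_cat ZD.
Qed.

Lemma zall_mul (V : nmodType) (Z : pred V) L c k :
  (forall x y, Z x -> Z y -> Z (x + y)) -> (0 < k)%N ->
  zall Z L (L + c) -> zall Z (k * L) (k * L + c).
Proof.
move=> ZD; case: k => // k _ ZL; elim: k => [|k IH]; first by rewrite mul1n.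
by rewrite mulSn; apply: zall_cat.
Qed.

Lemma zall_extract (V : nmodType) (Z : pred V) L t N (S : seq V) :
  zall Z L t -> (L * N.-1 + t <= size S)%N ->
  exists (B : seq (seq V)) (U : seq V), [/\ perm_eq S (flatten B ++ U), size B = N &
    all (fun T => (size T == L) && Z (\sum_(x <- T) x)) B].
Proof.
move=> ZL; elim: N S => [|N IH] S tS; first by exists [::], S.
have [|T [U [pS sT ZT]]] := ZL S; first by move: tS; lia.
have sz := perm_size_cat pS.
case: N IH tS => [|N] IH tS.
  by exists [:: T], U; split=> //=; rewrite ?cats0 // sT eqxx ZT.
have [|B [U' [pU sB aB]]] := IH U; first by move: tS => /=; lia.
exists (T :: B), U'; split=> /=; last by rewrite sT eqxx ZT.
- by rewrite (perm_trans pS) // -catA perm_cat2l.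
- by rewrite sB.
Qed.

(* Vectors with natural entries stand for their classes modulo every n. *)
Definition dvdv (r n : nat) (x : 'rV[nat]_r) : bool := [forall j, n %| x ord0 j]%N.

Lemma dvdvP r n (x : 'rV[nat]_r) :
  reflect (forall j, n %| x ord0 j)%N (dvdv n x).
Proof. exact: forallP. Qed.

Lemma dvdvD r n (x y : 'rV[nat]_r) : dvdv n x -> dvdv n y -> dvdv n (x + y).
Proof.
move=> /dvdvP nx /dvdvP ny; apply/dvdvP => j.
by rewrite mxE; exact: (dvdn_add (nx j) (ny j)).
Qed.

Lemma sum_flatten (V : nmodType) (B : seq (seq V)) :
  \sum_(x <- flatten B) x = \sum_(T <- B) \sum_(x <- T) x.
Proof.
elim: B => [|T B IH]; first by rewrite !big_nil.
by rewrite big_cons /= big_cat IH.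
Qed.

Lemma perm_flatten_cat (T : eqType) (A B C : seq (seq T)) :
  perm_eq A (B ++ C) -> perm_eq (flatten A) (flatten B ++ flatten C).
Proof. by move=> /perm_flatten; rewrite flatten_cat. Qed.

(** The inductive method: extract [u] disjoint blocks of length [m] with sums divisible by [m],
    divide these sums by [m], and select [L] blocks whose quotients sum to 0 modulo [q]. When the
    last block is extracted, [t] terms are still left. *)
Lemma zall_comp r m q L t u :
  (0 < m)%N -> zall (@dvdv r m) m t -> zall (@dvdv r q) L u ->
  zall (@dvdv r (m * q)) (m * L) (m * u.-1 + t).
Proof.
move=> m0 Zm Zq S tS.
have [B [U [pS sB aB]]] := zall_extract Zm tS.
pose g (T : seq 'rV[nat]_r) := \row_j ((\sum_(x <- T) x)%R ord0 j %/ m)%N.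
have [|T [W [pT sT ZT]]] := Zq (map g B); first by rewrite size_map sB.
have [B' pB' B'E] := perm_map_lift pT.
pose B1 := take L B'; pose B2 := drop L B'.
have TE : map g B1 = T by rewrite map_take B'E -sT take_size_cat.
have B1B : {subset B1 <= B}.
  by move=> x xB; rewrite (perm_mem pB') -(cat_take_drop L B') mem_cat xB.
exists (flatten B1), (flatten B2 ++ U); split.
- rewrite (perm_trans pS) // catA perm_cat2r perm_flatten_cat //.
  by rewrite cat_take_drop.
- rewrite size_flatten /shape.
  have /all_pred1P -> : all (pred1 m) (map size B1).
    by apply/allP => _ /mapP[x /B1B xB ->]; have /andP[] := allP aB _ xB.
  by rewrite sumn_nseq size_map -sT -TE size_map.
- rewrite sum_flatten.
  have -> : \sum_(T0 <- B1) \sum_(x <- T0) x = (\sum_(x <- T) x) *+ m.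
    rewrite -TE big_map -sumrMnl; apply: eq_big_seq => x /B1B xB.
    have /andP[_ /dvdvP Zx] := allP aB _ xB.
    apply/rowP => j; rewrite mulmxnE mxE.
    by rewrite -[LHS](divnK (Zx j)) -mulr_natr natn.
  apply/dvdvP => j; rewrite mulmxnE -mulr_natr natn mulnC.
  by rewrite dvdn_mul //; move/dvdvP: ZT.
Qed.

Lemma dvdv_Fp (r p : nat) (s : seq 'rV[nat]_r) : prime p ->
  \sum_(x <- [seq map_mx (fun k : nat => k%:R : 'F_p) x | x <- s]) x = 0 ->
  dvdv p (\sum_(x <- s) x).
Proof.
move=> pp s0; apply/dvdvP => j; rewrite (dvdn_pcharf (pchar_Fp pp)).
move/rowP/(_ j): s0; rewrite big_map !summxE mxE => s0.
rewrite natr_sum -[X in _ == X]s0; by apply/eqP/eq_bigr => x _; rewrite mxE.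
Qed.

Lemma zall_Fp (r p L t : nat) : prime p ->
  zall (fun x : 'rV['F_p]_r => x == 0) L t -> zall (@dvdv r p) L t.
Proof.
move=> pp ZL S tS.
apply: (@zsub_map _ _ (map_mx (fun k : nat => k%:R : 'F_p))
  _ (fun x : 'rV['F_p]_r => x == 0)) => [s _ _ /eqP|].
  exact: dvdv_Fp.
by apply: ZL; rewrite size_map.
Qed.

(** * Transfer to C_n^r and the lower bound *)

Lemma sum_ord_mod (n : nat) (s : seq 'I_n.+1) :
  ((\sum_(x <- s) x)%R : nat) = ((\sum_(x <- s) (x : nat)) %% n.+1)%N.
Proof.
elim: s => [|x s IH]; first by rewrite !big_nil.
by rewrite !big_cons /= IH modnDmr.
Qed.

Lemma s_inv_le (n r k t : nat) : (0 < n)%N -> (0 < t)%N ->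
  zall (@dvdv r n) (k * n) t -> (s_inv (Cpow n r) (k * n) <= t)%N.
Proof.
move=> n0 t0 ZL.
have [|_ _ smin] := @s_invP (Cpow n r) (k * n).
  by move=> g; apply: Cpow_mulrn.
apply: smin => // S tS; case: n n0 ZL S tS => // n _ ZL S tS.
have [] : zsub (fun x : Cpow n.+1 r => x == 0) (k * n.+1) S.
  apply: (@zsub_map _ _ (fun x : Cpow n.+1 r => map_mx (fun i : 'I_n.+1 => i : nat) x)
    _ (@dvdv r n.+1)); last by apply: ZL; rewrite size_map.
  move=> s _ _ /dvdvP sn; apply/eqP/rowP => j; rewrite mxE; apply: val_inj.
  rewrite summxE -(big_map (fun x : Cpow n.+1 r => x ord0 j) xpredT id).
  apply: etrans (sum_ord_mod _) _; rewrite big_map.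
  have /eqP := sn j; rewrite big_map summxE => sj.
  by rewrite -[RHS]sj; congr (_ %% _)%N; apply: eq_bigr => x _; rewrite mxE.
move=> T [U [pS sT /eqP T0]]; exists T; split=> // x.
by rewrite (permP pS) count_cat leq_addr.
Qed.

Lemma s_inv_ge (n r k : nat) : (1 < n)%N -> (0 < k)%N ->
  (k * n + r * n.-1 <= s_inv (Cpow n r) (k * n))%N.
Proof.
case: n => [|[|n]] // _ k0; rewrite leqNgt; apply/negP => lt_s.
set N := n.+2 in lt_s *; have kN : (0 < k * N)%N by rewrite muln_gt0 k0.
have [m mE] : {m | m = N.-1} by exists N.-1.
pose G := Cpow N r.
have [|_ sP _] := @s_invP (Cpow N r) (k * N); first by move=> g; apply: Cpow_mulrn.
pose e (j : 'I_r) : G := delta_mx ord0 j.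
pose S : seq G := nseq (k * N).-1 0 ++ flatten [seq nseq m (e j) | j <- enum 'I_r].
have sS : size S = ((k * N).-1 + r * m)%N.
  rewrite size_cat size_nseq size_flatten /shape -map_comp; congr addn.
  rewrite (eq_map (g := fun=> m)) ?sumnE ?big_map; last first.
    by move=> j /=; rewrite size_nseq.
  by rewrite -enumT big_enum /= sum_nat_const card_ord.
have [|T [TS sT T0]] := sP S.
  by rewrite sS mE; lia.
have [T' subT' pT] := (count_subseqP T S).1 TS.
have cS (j : 'I_r) : (\sum_(x <- S) (x ord0 j : nat) = m)%N.
  rewrite big_cat /= big_nseq iter_addn_0 mxE mul0n add0n.
  rewrite big_flatten big_map. rewrite big_enum /= (bigD1 j) //= big_nseq iter_addn_0.
  rewrite mxE !eqxx /= mul1n big1 ?addn0 // => i ij.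
  by rewrite big_nseq iter_addn_0 mxE /= eq_sym (negPf ij) mul0n.
(* In each coordinate the natural entries of [T] sum to at most [N - 1] and to a multiple of [N],
   hence to 0. So [T] consists of zeros, and [S] has one zero too few. *)
have T0' x : x \in T -> x = 0.
  move=> xT; apply/rowP => j; rewrite mxE.
  have le : (\sum_(y <- T) (y ord0 j : nat) <= m)%N.
    rewrite -(cS j) (perm_big _ pT) /=.
    have [s' ps'] := perm_to_subseq subT'.
    by rewrite [leqRHS](perm_big _ ps') big_cat leq_addr.
  have dv : ((\sum_(y <- T) (y ord0 j : nat)) %% N = 0)%N.
    have /rowP/(_ j) := T0; rewrite summxE mxE => /(congr1 (@nat_of_ord _)) sj.
    apply: etrans sj; apply: esym.
    rewrite -(big_map (fun x : G => x ord0 j) xpredT id).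
    by apply: etrans (sum_ord_mod _) _; rewrite big_map.
  have sum0 : (\sum_(y <- T) (y ord0 j : nat) = 0)%N.
    by move: dv; rewrite modn_small // (leq_ltn_trans le) // mE.
  apply: val_inj; apply/eqP; rewrite -leqn0; apply: leq_trans (eq_leq sum0).
  by rewrite (big_rem x xT) leq_addr.
have := TS 0; rewrite count_cat.
have /all_pred1P -> : all (pred1 0) T.
  by apply/allP => x xT; apply/eqP/T0'.
rewrite sT !count_nseq /= eqxx !mul1n count_flatten -map_comp.
rewrite (eq_map (g := fun=> 0%N)) ?sumnE ?big_map ?big1 // ?addn0; last first.
  move=> j /=; rewrite count_nseq /= (_ : _ == _ = false) //.
  by apply/eqP => /rowP/(_ j); rewrite !mxE !eqxx.
by lia.
Qed.

(** * The linear bound of Alon and Dubiner *)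

Definition dot (F : fieldType) (d : nat) (u x : 'rV[F]_d) : F := (u *m x^T) ord0 ord0.

Lemma dotDr (F : fieldType) d (u x y : 'rV[F]_d) : dot u (x + y) = dot u x + dot u y.
Proof. by rewrite /dot linearD mulmxDr mxE. Qed.

Lemma dotBr (F : fieldType) d (u x y : 'rV[F]_d) : dot u (x - y) = dot u x - dot u y.
Proof. by rewrite /dot linearB mulmxBr !mxE. Qed.

Lemma dotMnr (F : fieldType) d (u x : 'rV[F]_d) n : dot u (x *+ n) = dot u x *+ n.
Proof.
elim: n => [|n IH]; last by rewrite !mulrS dotDr IH.
by rewrite !mulr0n /dot trmx0 mulmx0 mxE.
Qed.

Lemma dotE (F : fieldType) d (u x : 'rV[F]_d) : dot u x = \sum_i u ord0 i * x ord0 i.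
Proof. by rewrite /dot mxE; apply: eq_bigr => i _; rewrite mxE. Qed.

Lemma dotC (F : fieldType) d (u x : 'rV[F]_d) : dot u x = dot x u.
Proof. by rewrite !dotE; apply: eq_bigr => i _; rewrite mulrC. Qed.

Lemma rV_neq0 (R : nmodType) d (u : 'rV[R]_d) : u != 0 -> exists i, u ord0 i != 0.
Proof.
move=> u0; apply/existsP; apply: contraR u0 => /existsPn u0; apply/eqP/rowP => i.
by rewrite mxE; apply/eqP; move: (u0 i); rewrite negbK.
Qed.

Lemma dot_neq0 (F : fieldType) d (u : 'rV[F]_d) : u != 0 -> exists x, dot u x = 1.
Proof.
move=> /rV_neq0[i ui].
exists ((u ord0 i)^-1 *: delta_mx ord0 i); rewrite dotE (bigD1 i) //= big1 => [|j ji].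
  by rewrite !mxE !eqxx mulr1 mulfV // addr0.
by rewrite !mxE (negPf ji) andbF !mulr0.
Qed.

(** * Second moments of hyperplane sections *)

Lemma card_dot0 (F : finFieldType) d (x : 'rV[F]_d.+1) :
  #|[set u | dot u x == 0]| = if x == 0 then (#|F| ^ d.+1)%N else (#|F| ^ d)%N.
Proof.
case: eqVneq => [->|x0].
  rewrite (_ : [set _ | _] = setT); first by rewrite cardsT card_mx mul1n.
  by apply/setP => u; rewrite !inE /dot trmx0 mulmx0 mxE eqxx.
have [u ux] := dot_neq0 x0; rewrite dotC in ux.
have F0 : (0 < #|F|)%N by apply/card_gt0P; exists 0.
have cV : #|{: 'rV[F]_d.+1}| = (#|F| ^ d.+1)%N by rewrite card_mx mul1n.
apply/eqP; rewrite -(eqn_pmul2l F0) -expnS -cV.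
pose f (cv : F * 'rV[F]_d.+1) := cv.2 + cv.1 *: u.
have sc c : dot (c *: u) x = c by rewrite /dot -scalemxAl mxE -/(dot u x) ux mulr1.
have dD v w : dot (v + w) x = dot v x + dot w x by rewrite dotC dotDr !(dotC x).
rewrite -[X in (X * _)%N]cardsT -cardsX -(@card_in_imset _ _ f).
  apply/eqP; apply: eq_card => v; rewrite inE.
  apply/imsetP; exists (dot v x, v - dot v x *: u); last by rewrite /f /= subrK.
  by rewrite !inE /= -scaleNr dD sc subrr.
move=> [c v] [c' v']; rewrite !inE /= => /eqP v0 /eqP v'0.
rewrite /f /= => E; have := congr1 (fun w : 'rV_d.+1 => dot w x) E.
rewrite /= !dD v0 v'0 !sc !add0r => cc; move: E; rewrite cc => /addIr -> //.
Qed.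

(** The discrete Radon transform of [f], with [u] as normal. *)
Definition proj (F : finFieldType) (R : nmodType) d (u : 'rV[F]_d) (f : 'rV[F]_d -> R)
  (c : F) : R := \sum_(x | dot u x == c) f x.

Lemma sum_proj (F : finFieldType) (R : nmodType) d (u : 'rV[F]_d) (f : 'rV[F]_d -> R) :
  \sum_c proj u f c = \sum_x f x.
Proof. by rewrite [RHS](partition_big (dot u) xpredT). Qed.

(** A Plancherel identity without characters: after expanding the squares, the pair (x, y) is
    counted once for every [u] orthogonal to x - y. The zero vector accounts for one copy of the
    squared sum. *)
Lemma sum_proj_sqr (F : finFieldType) (R : realDomainType) d (f : 'rV[F]_d.+1 -> R) :
  \sum_(u | u != 0) \sum_c proj u f c ^+ 2 =
  (#|F| ^ d).-1%:R * (\sum_x f x) ^+ 2 + (#|F| ^ d * #|F|.-1)%:R * \sum_x f x ^+ 2.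
Proof.
have F0 : (0 < #|F|)%N by apply/card_gt0P; exists 0.
have P0 : (0 < #|F| ^ d)%N by rewrite expn_gt0 F0.
apply: (@addrI _ ((\sum_x f x) ^+ 2)); rewrite addrA.
have -> : (\sum_x f x) ^+ 2 + (#|F| ^ d).-1%:R * (\sum_x f x) ^+ 2 =
    (#|F| ^ d)%:R * (\sum_x f x) ^+ 2.
  by rewrite -[in RHS](prednK P0) -natr1 mulrDl mul1r addrC.
transitivity (\sum_u \sum_c proj u f c ^+ 2).
  rewrite [RHS](bigD1 0) //=; congr (_ + _).
  rewrite [RHS](bigD1 0) //= [X in _ + X]big1 => [|c c0].
    rewrite addr0 /proj; congr (_ ^+ 2); apply: eq_bigl => x.
    by rewrite /dot mul0mx mxE eqxx.
  rewrite /proj big1 ?expr0n // => x; rewrite /dot mul0mx mxE eq_sym => /eqP c00.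
  by rewrite c00 eqxx in c0.
transitivity (\sum_x \sum_y f x * f y * #|[set u | dot u (x - y) == 0]|%:R).
  transitivity (\sum_u \sum_x \sum_y f x * f y * (dot u (x - y) == 0)%:R).
    apply: eq_bigr => u _; rewrite [RHS](partition_big (dot u) xpredT) //=.
    apply: eq_bigr => c _; rewrite expr2 /proj mulr_suml; apply: eq_bigr => x /eqP ux.
    rewrite mulr_sumr [RHS](bigID (fun y => dot u y == c)) /= [X in _ + X]big1 ?addr0.
      by apply: eq_bigr => y /eqP uy; rewrite dotBr ux uy subrr eqxx mulr1.
    by move=> y uy; rewrite dotBr ux subr_eq0 eq_sym (negPf uy) mulr0.
  rewrite exchange_big; apply: eq_bigr => x _; rewrite exchange_big.
  apply: eq_bigr => y _; rewrite -mulr_sumr; congr (_ * _).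
  by rewrite -natr_sum -sum1dep_card [in RHS]big_mkcond /=.
have E x y : f x * f y * #|[set u | dot u (x - y) == 0]|%:R =
    (#|F| ^ d)%:R * (f x * f y) + (#|F| ^ d * #|F|.-1)%:R * (f x * f y) * (y == x)%:R.
  rewrite card_dot0 subr_eq0 eq_sym.
  case: eqP => _; rewrite ?mulr1 ?mulr0 ?addr0; last ring.
  by rewrite -mulrDl -natrD mulrC -mulnS prednK // expnSr.
under eq_bigr => x _ do under eq_bigr => y _ do rewrite E.
under eq_bigr => x _ do rewrite big_split /= -mulr_sumr -mulr_sumr.
rewrite big_split -mulr_sumr -mulr_suml -expr2; congr (_ + _).
rewrite mulr_sumr; apply: eq_bigr => x _; rewrite (bigD1 x) //= eqxx mulr1 big1.
  by rewrite addr0 expr2.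
by move=> y /negPf ->; rewrite mulr0.
Qed.

(** A coordinate [i] with [u ord0 i != 0] is determined by the others on the hyperplane, so [col' i]
    lowers the dimension without loss. *)
Lemma dot_col'_eq0 (F : fieldType) d (u x : 'rV[F]_d.+1) (i : 'I_d.+1) :
  u ord0 i != 0 -> dot u x = 0 -> col' i x = 0 -> x = 0.
Proof.
move=> ui ux xi; have x0 j : j != i -> x ord0 j = 0.
  case: (unliftP i j) => [k ->|->]; last by rewrite eqxx.
  by move=> _; have /rowP/(_ k) := xi; rewrite !mxE.
move: ux; rewrite dotE (bigD1 i) //= big1 => [|j ji]; last by rewrite x0 ?mulr0.
rewrite addr0 => /eqP; rewrite mulf_eq0 (negPf ui) /= => /eqP xi0.
by apply/rowP => j; rewrite [RHS]mxE; have [->|/x0] := eqVneq j i.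
Qed.

Lemma sum_shift (V : finZmodType) (R : nmodType) (f : V -> R) (v : V) :
  \sum_x f (x + v) = \sum_x f x.
Proof. by rewrite [RHS](reindex_inj (addIr v)). Qed.

Lemma natr_Fp_eq0 (p j : nat) : prime p -> (0 < j < p)%N -> (j%:R : 'F_p) != 0.
Proof.
move=> pp /andP[j0 jp]; rewrite -(dvdn_pcharf (pchar_Fp pp)).
by rewrite gtnNdvd.
Qed.

(* Distinct multiples of l are independent under averaging over l, so the
   cross terms vanish. *)
Lemma sum_progression_sqr (R : realDomainType) (p J : nat) (n : 'F_p -> R) :
  prime p -> (J <= p)%N -> \sum_c n c = 0 ->
  \sum_l \sum_c (\sum_(j < J) n (c + l *+ j)) ^+ 2 = (J * p)%:R * \sum_c n c ^+ 2.
Proof.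
move=> pp Jp n0.
have E (i j : 'I_J) : \sum_l \sum_c n (c + l *+ i) * n (c + l *+ j) =
    (i == j)%:R * (p%:R * \sum_c n c ^+ 2).
  have [->|ij] := eqVneq i j.
    rewrite mul1r (eq_bigr (fun=> \sum_c n c ^+ 2)); last first.
      move=> l _; rewrite -[RHS](sum_shift _ (l *+ j)).
      by apply: eq_bigr => c _; rewrite expr2.
    by rewrite sumr_const card_Fp // mulr_natl.
  have gen (a b : 'I_J) : (a < b)%N ->
      \sum_l \sum_c n (c + l *+ a) * n (c + l *+ b) = 0.
    move=> ab; have d0 : ((b - a)%:R : 'F_p) != 0.
      by apply: natr_Fp_eq0 => //; have := ltn_ord b; lia.
    transitivity (\sum_l \sum_c n c * n (c + (b - a)%:R * l)).
      apply: eq_bigr => l _; rewrite -[RHS](sum_shift _ (l *+ a)).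
      apply: eq_bigr => c _; rewrite -addrA mulr_natl -mulrnDr subnKC //.
      exact: ltnW.
    rewrite exchange_big big1 // => c _; rewrite -mulr_sumr.
    have <- : \sum_l n l = \sum_l n (c + (b - a)%:R * l); last by rewrite n0 mulr0.
    apply: reindex_inj => x y /addrI; exact: mulfI.
  rewrite mul0r; have [ab|ba|/val_inj ab] := ltngtP i j; first exact: gen.
    rewrite -[RHS](gen _ _ ba); apply: eq_bigr => l _; apply: eq_bigr => c _.
    exact: mulrC.
  by rewrite ab eqxx in ij.
transitivity (\sum_(i < J) \sum_(j < J) \sum_l \sum_c n (c + l *+ i) * n (c + l *+ j)).
  transitivity (\sum_l \sum_(i < J) \sum_(j < J) \sum_c n (c + l *+ i) * n (c + l *+ j)).
    apply: eq_bigr => l _.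
    transitivity (\sum_c \sum_(i < J) \sum_(j < J) n (c + l *+ i) * n (c + l *+ j)).
      apply: eq_bigr => c _; rewrite expr2 mulr_suml; apply: eq_bigr => i _.
      by rewrite mulr_sumr.
    by rewrite exchange_big; apply: eq_bigr => i _; rewrite exchange_big.
  by rewrite exchange_big; apply: eq_bigr => i _; rewrite exchange_big.
under eq_bigr => i _ do under eq_bigr => j _ do rewrite E.
rewrite (eq_bigr (fun=> p%:R * \sum_c n c ^+ 2)); last first.
  move=> i _; rewrite (bigD1 i) //= eqxx mul1r [X in _ + X]big1 ?addr0 // => j.
  by rewrite eq_sym => /negPf ->; rewrite mul0r.
by rewrite sumr_const card_ord -[LHS]mulr_natl natrM mulrA.
Qed.

Lemma sum_count_le (T : finType) (R : realDomainType) (s : seq T) (g : T -> R) b :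
  (forall x, 0 <= g x) -> (forall x, count_mem x s <= b)%N ->
  \sum_(x <- s) g x <= b%:R * \sum_x g x.
Proof.
move=> g0 sb; rewrite -[X in \sum_(x <- X) _]map_id.
have -> : \sum_(x <- map id s) g x = \sum_x (count_mem x s)%:R * g x.
  rewrite big_map; elim: s {sb} => [|y s IH] /=.
    by rewrite big_nil big1 // => x _; rewrite mul0r.
  rewrite big_cons IH.
  rewrite [RHS](eq_bigr (fun x => (y == x)%:R * g x + (count_mem x s)%:R * g x)).
    rewrite big_split /=; congr (_ + _).
    rewrite (bigD1 y) //= eqxx mul1r big1 ?addr0 // => x.
    by rewrite eq_sym => /negPf ->; rewrite mul0r.
  by move=> x _; rewrite natrD mulrDl.
by rewrite mulr_sumr; apply: ler_sum => x _; rewrite ler_wpM2r // ler_nat.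
Qed.

(* Spectral gap of the Cayley graph of a sequence not concentrated on affine
   hyperplanes, in terms of progressions in the directions of its terms. *)
Lemma spectral_gap (R : realDomainType) (p d b J : nat) (A : seq 'rV['F_p]_d.+1)
    (f : 'rV['F_p]_d.+1 -> R) :
  prime p -> (J <= p)%N ->
  (forall (u : 'rV['F_p]_d.+1) c, u != 0 ->
     (count (fun x => dot u x == c) A <= b)%N) ->
  \sum_x f x = 0 ->
  \sum_(a <- A) \sum_x (\sum_(j < J) f (x + a *+ j)) ^+ 2 <=
  (b * (J * p))%:R * \sum_x f x ^+ 2.
Proof.
move=> pp Jp Ab f0; have pg := prime_gt1 pp.
pose K := (#|'F_p| ^ d * #|'F_p|.-1)%N.
have K0 : (0 : R) < K%:R by rewrite ltr0n /K card_Fp // muln_gt0 expn_gt0; lia.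
have mean0 (h : 'rV['F_p]_d.+1 -> R) : \sum_x h x = 0 ->
    K%:R * \sum_x h x ^+ 2 = \sum_(u | u != 0) \sum_c proj u h c ^+ 2.
  by move=> h0; rewrite sum_proj_sqr h0 expr0n mulr0 add0r.
rewrite -(ler_pM2l K0) mulrCA mean0 // mulr_sumr.
pose fa a x := \sum_(j < J) f (x + a *+ j).
have fa0 a : \sum_x fa a x = 0.
  by rewrite exchange_big big1 // => j _; rewrite sum_shift.
rewrite (eq_bigr (fun a => \sum_(u | u != 0) \sum_c proj u (fa a) c ^+ 2)); last first.
  by move=> a _; exact: mean0 (fa0 a).
rewrite exchange_big mulr_sumr; apply: ler_sum => u u0 /=.
(* The projected progression sums depend on [a] only through [dot u a], a value shared by at most
   [b] terms of [A]. *)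
pose g l := \sum_c (\sum_(j < J) proj u f (c + l *+ j)) ^+ 2.
have -> : \sum_(a <- A) \sum_c proj u (fa a) c ^+ 2 = \sum_(l <- map (dot u) A) g l.
  rewrite big_map; apply: eq_bigr => a _; apply: eq_bigr => c _; congr (_ ^+ 2).
  rewrite /proj exchange_big; apply: eq_bigr => j _.
  rewrite [RHS](reindex_inj (addIr (a *+ j))) /=.
  by apply: eq_bigl => x; rewrite dotDr dotMnr (inj_eq (addIr _)).
apply: le_trans (sum_count_le (b := b) _ _) _.
- by move=> l; apply: sumr_ge0 => c _; apply: sqr_ge0.
- by move=> c; rewrite count_map; apply: Ab.
rewrite sum_progression_sqr ?sum_proj //. by rewrite (natrM _ b) mulrA.
Qed.

(** * Growth of a set under translations *)

Definition escape (V : finZmodType) (Y : {set V}) (v : V) : nat :=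
  #|[set y in Y | y + v \notin Y]|.

Lemma escape0 (V : finZmodType) (Y : {set V}) : escape Y 0 = 0%N.
Proof.
by apply/eqP; rewrite cards_eq0; apply/eqP/setP => y; rewrite !inE addr0 andbN.
Qed.

(** A point leaving [Y] under u + v leaves at the first step or at the second. Hence a combination
    of vectors that moves many points out of [Y] contains a vector that does. *)
Lemma escapeD (V : finZmodType) (Y : {set V}) (u v : V) :
  (escape Y (u + v)%R <= escape Y u + escape Y v)%N.
Proof.
rewrite {3}/escape -(card_imset _ (addIr (- u))) /escape.
apply: leq_trans (leq_card_setU _ _); apply/subset_leq_card/subsetP => y.
rewrite !inE => /andP[yY yuv]; rewrite yY /=; case: (boolP (y + u \in Y)) => //= yu.
apply/imsetP; exists (y + u); last by rewrite addrK.
by rewrite inE yu -addrA.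
Qed.

Lemma escapeMn (V : finZmodType) (Y : {set V}) (v : V) j :
  (escape Y (v *+ j)%R <= j * escape Y v)%N.
Proof.
elim: j => [|j IH]; first by rewrite mulr0n escape0.
by rewrite mulrS mulSn; apply: leq_trans (escapeD _ _ _) _; rewrite leq_add2l.
Qed.

Lemma escape_sum (V : finZmodType) (Y : {set V}) (I : finType) (f : I -> V) :
  (escape Y (\sum_i f i)%R <= \sum_i escape Y (f i))%N.
Proof.
elim/big_rec2: _ => [|i m v _ IH]; first by rewrite escape0.
by apply: leq_trans (escapeD _ _ _) _; rewrite leq_add2l.
Qed.

Lemma card_stay (V : finZmodType) (Y : {set V}) (v : V) :
  (#|[set y in Y | (y + v)%R \in Y]| + escape Y v = #|Y|)%N.
Proof.
rewrite /escape -[RHS](cardsID [set y | y + v \in Y]) addnC addnC.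
by congr (_ + _)%N; apply: eq_card => y; rewrite !inE // andbC.
Qed.

Lemma card_sumset2 (V : finZmodType) (Y : {set V}) (a b : V) :
  #|[set y + a | y in Y] :|: [set y + b | y in Y]| = (#|Y| + escape Y (b - a)%R)%N.
Proof.
have -> : [set y + a | y in Y] :|: [set y + b | y in Y] =
  [set y + a | y in Y] :|: [set y + b | y in [set y in Y | y + (b - a) \notin Y]].
  apply/setP => z; rewrite !inE; case: imsetP => //= za; apply/imsetP/imsetP.
    move=> [y yY zE]; exists y => //; rewrite inE yY /=; apply: contra_notN za => yb.
    by exists (y + (b - a)) => //; rewrite zE addrA subrK.
  by move=> [y]; rewrite inE => /andP[yY _] ->; exists y.
rewrite cardsU disjoint_setI0 ?cards0 ?subn0.
  by rewrite !card_imset //; apply: addIr.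
apply/pred0P => z /=; apply/negP => /andP[/imsetP[y yY ->] /imsetP[x]].
by rewrite inE => /andP[xY xY'] E; move: xY'; rewrite addrA -E addrK yY.
Qed.

(* If no row moved many points of Y out of Y, every vector v of the box spanned
   by the rows would keep more than a quarter of Y inside Y; but there are at most
   #|Y| ^ 2 pairs (y, v) with y and y + v in Y. *)
Lemma box_growth (p d J : nat) (M : 'M['F_p]_d.+1) (Y : {set 'rV['F_p]_d.+1}) :
  prime p -> M \in unitmx -> (J <= p)%N -> (4 * #|Y| <= J ^ d.+1)%N ->
  exists i, (3 * #|Y| <= 4 * d.+1 * J * escape Y (row i M))%N.
Proof.
move=> pp uM Jp YJ; apply/existsP; apply: contraT => /existsPn noti.
pose g (j : {ffun 'I_d.+1 -> 'I_J}) : 'rV['F_p]_d.+1 := \sum_i row i M *+ j i.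
have gE j : g j = (\row_i ((j i)%:R : 'F_p)) *m M.
  by rewrite mulmx_sum_row; apply: eq_bigr => i _; rewrite mxE scaler_nat.
have g_inj : injective g.
  move=> j j'; rewrite !gE => /(congr1 (mulmx^~ (invmx M))).
  rewrite /= !mulmxK // => E; apply/ffunP => i; apply: val_inj => /=.
  have /rowP/(_ i) := E; rewrite !mxE => {}E.
  have aux (a b : 'I_J) : (a%:R : 'F_p) = b%:R -> (a <= b)%N.
    move=> ab; rewrite leqNgt; apply/negP => ba.
    have /(natr_Fp_eq0 pp) : (0 < a - b < p)%N by have := ltn_ord a; lia.
    by rewrite natrB ?ab ?subrr ?eqxx // ltnW.
  by apply/eqP; rewrite eqn_leq !aux.
pose m := (\sum_i escape Y (row i M))%N.
have m_lt : (4 * J * m < 3 * #|Y|)%N.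
  rewrite -(ltn_pmul2l (ltn0Sn d)).
  have -> : (d.+1 * (4 * J * m) = \sum_i (4 * d.+1 * J * escape Y (row i M)))%N.
    by rewrite -big_distrr /= -/m; lia.
  have -> : (d.+1 * (3 * #|Y|) = \sum_(i < d.+1) 3 * #|Y|)%N.
    by rewrite sum_nat_const card_ord.
  rewrite !big_ord_recl -addSn.
  apply: leq_add; first by rewrite ltnNge.
  by apply: leq_sum => i _; apply: ltnW; rewrite ltnNge.
have esc j : (escape Y (g j) <= J * m)%N.
  rewrite /m big_distrr /=; apply: leq_trans (escape_sum _ _) _.
  apply: leq_sum => i _; apply: leq_trans (escapeMn _ _ _) _.
  by rewrite leq_mul2r ltnW ?orbT.
have up : (\sum_j #|[set y in Y | (y + g j)%R \in Y]| <= #|Y| * #|Y|)%N.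
  rewrite -sum_nat_const.
  rewrite (eq_bigr (fun j => \sum_(y in Y) if (y + g j)%R \in Y then 1 else 0))%N.
  2: by move=> j _; rewrite -sum1_card -big_mkcondr; apply: eq_bigl => y; rewrite inE.
  rewrite exchange_big /=; apply: leq_sum => y _.
  have inj : injective (fun j => y + g j) by move=> j j' /addrI /g_inj.
  rewrite -big_mkcond /= sum1_card -(card_imset _ inj).
  by apply/subset_leq_card/subsetP => _ /imsetP[j yj ->].
(* Fewer than 3/4 of the points escape, so each count is at least (|Y| + 1) / 4; the extra 1 makes
   this incompatible with [up] and [YJ]. *)
have lo : (J ^ d.+1 * #|Y|.+1 <= \sum_j 4 * #|[set y in Y | (y + g j)%R \in Y]|)%N.
  have -> : (J ^ d.+1 = #|{ffun 'I_d.+1 -> 'I_J}|)%N by rewrite card_ffun !card_ord.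
  rewrite -sum_nat_const; apply: leq_sum => j _.
  move: m_lt (esc j) (card_stay Y (g j)); rewrite -mulnA.
  by move: (escape _ _) (J * m)%N #|_| #|_| => e t n s; lia.
move: lo; rewrite -big_distrr /=; move: up YJ m_lt; set s := (\sum_j _)%N.
move: #|_| s => n s; nia.
Qed.

Lemma sum_indic (T : finType) (R : pzSemiRingType) (A : {set T}) :
  \sum_x (x \in A)%:R = #|A|%:R :> R.
Proof.
rewrite -sum1_card natr_sum [RHS]big_mkcond; apply: eq_bigr => x _.
by case: (x \in A).
Qed.

Lemma ex_le_average (I : eqType) (R : realDomainType) (s : seq I) (F : I -> R) c :
  (0 < size s)%N -> \sum_(i <- s) F i <= c *+ size s ->
  exists2 i, i \in s & F i <= c.
Proof.
elim: s => // i s IH _; rewrite big_cons mulrS => Fs.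
have [Fi|Fi] := leP (F i) c; first by exists i; rewrite ?mem_head.
have {}Fs : \sum_(j <- s) F j < c *+ size s.
  by rewrite -(ltrD2l c); apply: lt_le_trans Fs; rewrite ltrD2r.
case: s IH Fs => [|j s] IH Fs; first by rewrite big_nil ltxx in Fs.
by have [k ks Fk] := IH isT (ltW Fs); exists k; rewrite // inE ks orbT.
Qed.

(* spectral_gap applied to the indicator of Y minus its mean. *)
Lemma hyperplane_growth (p d b J : nat) (A : seq 'rV['F_p]_d.+1)
    (Y : {set 'rV['F_p]_d.+1}) :
  prime p -> (0 < J <= p)%N ->
  (forall (u : 'rV['F_p]_d.+1) c, u != 0 ->
     (count (fun x => dot u x == c) A <= b)%N) ->
  (0 < size A)%N -> (4 * b * p <= J * size A)%N ->
  (2 * #|Y| <= p ^ d.+1)%N ->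
  exists2 a, a \in A & (#|Y| <= 4 * J * escape Y a)%N.
Proof.
move=> pp /andP[J0 Jp] Ab A0 bA Y2.
have cV : #|{: 'rV['F_p]_d.+1}| = (p ^ d.+1)%N by rewrite card_mx mul1n card_Fp.
set N := (p ^ d.+1)%N in cV Y2.
(* The indicator minus its mean, multiplied by [N] to stay within the integers. *)
pose y : int := #|Y|%:R; pose f x : int := N%:R * (x \in Y)%:R - y.
have sumY : \sum_x (x \in Y)%:R = y.
  exact: sum_indic.
have f0 : \sum_x f x = 0.
  by rewrite sumrB -mulr_sumr sumY sumr_const cV mulr_natl subrr.
have corr v : \sum_x f x * f (x + v) = N%:R * (N%:R * (y - (escape Y v)%:R) - y ^+ 2).
  have E x : f x * f (x + v) = N%:R * (N%:R * ((x \in Y) && (x + v \in Y))%:R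
     - y * (x + v \in Y)%:R) - y * f x.
    rewrite /f -mulnb natrM; ring.
  under eq_bigr => x _ do rewrite E.
  rewrite sumrB -[X in _ - X]mulr_sumr f0 mulr0 subr0 -mulr_sumr sumrB -!mulr_sumr.
  have -> : \sum_x (x + v \in Y)%:R = y by rewrite (sum_shift (fun x => (x \in Y)%:R)).
  have -> : \sum_x ((x \in Y) && (x + v \in Y))%:R = y - (escape Y v)%:R.
    rewrite /y -(card_stay Y v) natrD addrK -sum_indic.
    by apply: eq_bigr => x _; rewrite inE.
  by rewrite expr2.
have [Sf SfE] : {s | s = \sum_x f x ^+ 2} by exists (\sum_x f x ^+ 2).
have Sf0 : 0 <= Sf by rewrite SfE; apply: sumr_ge0 => x _; apply: sqr_ge0.
have SfE' : Sf = N%:R * (N%:R * y - y ^+ 2).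
  rewrite SfE -[X in X - y ^+ 2](_ : N%:R * (y - (escape Y 0)%:R) = _).
    by rewrite -corr; apply: eq_bigr => x _; rewrite addr0 expr2.
  by rewrite escape0 subr0.
pose fa a x := \sum_(j < J) f (x + a *+ j).
have gap := spectral_gap pp Jp Ab f0; rewrite -SfE in gap.
(* Averaging the spectral gap over [A]: for some [a] the progression sums have second moment at most
   J^2 / 4 times that of [f]. *)
have [a aA fa_le] : exists2 a, a \in A & 4 * \sum_x fa a x ^+ 2 <= (J ^ 2)%:R * Sf.
  apply: ex_le_average => //; rewrite -mulr_sumr.
  apply: le_trans (ler_wpM2l _ gap) _ => //.
  rewrite -[leRHS]mulr_natr mulrAC mulrA -natrM -natrM ler_wpM2r // ler_nat.
  rewrite -mulnn -mulnA; apply: leq_trans (leq_mul (leqnn J) bA).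
  by rewrite !mulnA leq_eqVlt; apply/orP; left; apply/eqP; lia.
(* Cauchy-Schwarz, in the form that the square of J f - 2 fa is nonnegative. *)
have cross : 2 * \sum_x f x * fa a x <= J%:R * Sf.
  have J0' : (0 : int) < (2 * J)%:R by rewrite ltr0n muln_gt0 J0.
  rewrite -(ler_pM2l J0').
  have -> : (2 * J)%:R * (2 * \sum_x f x * fa a x) =
      \sum_x 2 * (J%:R * f x) * (2 * fa a x).
    by rewrite !mulr_sumr; apply: eq_bigr => x _; rewrite natrM; ring.
  apply: (@le_trans _ _ (\sum_x ((J ^ 2)%:R * f x ^+ 2 + 4 * fa a x ^+ 2))).
    apply: ler_sum => x _; rewrite -subr_ge0 natrX.
    rewrite (_ : _ - _ = (J%:R * f x - 2 * fa a x) ^+ 2) ?sqr_ge0 //; ring.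
  rewrite big_split -!mulr_sumr -SfE /=.
  have -> : (2 * J)%:R * (J%:R * Sf) = (J ^ 2)%:R * Sf + (J ^ 2)%:R * Sf.
    by rewrite natrX natrM; ring.
  by rewrite lerD2l.
(* Some translate of [f] along the progression has correlation with [f] at most half the second
   moment of [f]. As |Y| is at most N / 2, a quarter of [Y] is moved out, and subadditivity passes
   this on to [a] at the cost of a factor [J]. *)
have [j _] : exists2 j, j \in enum 'I_J & 2 * \sum_x f x * f (x + a *+ j) <= Sf.
  apply: ex_le_average; first by rewrite size_enum_ord.
  rewrite size_enum_ord -[leRHS]mulr_natl; apply: le_trans cross.
  rewrite -mulr_sumr ler_pM2l // big_enum /= exchange_big /= le_eqVlt.
  by apply/orP; left; apply/eqP; apply: eq_bigr => x _; rewrite mulr_sumr.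
rewrite corr SfE' => esc_j; exists a => //.
have N0 : (0 < N)%N by rewrite expn_gt0 prime_gt0.
have : (#|Y| <= 4 * escape Y (a *+ j)%R)%N.
  move: esc_j; rewrite mulrCA ler_pM2l ?ltr0n //.
  move: Y2 N0; rewrite /y; move: #|_| (escape _ _) => n e.
  nia.
move=> /leq_trans; apply; rewrite -mulnA leq_mul2l /=.
by apply: leq_trans (escapeMn _ _ _) _; rewrite leq_mul2r ltnW ?orbT.
Qed.

(* Every element of Y is the sum of t terms of S chosen from t disjoint pairs
   of terms, U being the sequence of terms not in these pairs. *)
Definition reach (V : finZmodType) (S : seq V) (t : nat) (Y : {set V}) (U : seq V) :=
  (size S = 2 * t + size U)%N /\
  forall y, y \in Y -> exists T T',
    [/\ perm_eq S (T ++ T' ++ U), size T = t & \sum_(x <- T) x = y].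

Lemma reach0 (V : finZmodType) (S : seq V) : reach S 0 [set 0] S.
Proof.
split=> // y; rewrite inE => /eqP ->; exists [::], [::]; split=> //.
by rewrite big_nil.
Qed.

Lemma reach_step (V : finZmodType) (S : seq V) t (Y : {set V}) U a b U' :
  reach S t Y U -> perm_eq U (a :: b :: U') ->
  reach S t.+1 ([set y + a | y in Y] :|: [set y + b | y in Y]) U'.
Proof.
move=> [sS rY] pU; split; first by rewrite sS (perm_size pU) /=; lia.
have step a' b' y : perm_eq U (a' :: b' :: U') -> y \in Y ->
    exists T T', [/\ perm_eq S (T ++ T' ++ U'), size T = t.+1 & \sum_(x <- T) x = y + a'].
  move=> pU' yY; have [T [T' [pS sT <-]]] := rY _ yY.
  exists (a' :: T), (b' :: T'); split; rewrite /= ?sT //; last first.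
    by rewrite big_cons addrC.
  rewrite (perm_trans pS) // (@perm_trans _ (T ++ T' ++ a' :: b' :: U')) //.
    by rewrite !perm_cat2l.
  rewrite perm_sym -cat_cons; apply/permP => P.
  by rewrite !(count_cat, cats0) /= !count_cat /=; lia.
move=> z /setUP[] /imsetP[y yY ->]; first exact: step pU yY.
apply: (step b a) => //.
by rewrite (perm_trans pU) // -(cat1s a) -(cat1s b U') -cat1s perm_catCA.
Qed.

Lemma reach_count (V : finZmodType) (S : seq V) t (Y : {set V}) U (P : pred V) :
  reach S t Y U -> (0 < #|Y|)%N -> (count P U <= count P S)%N.
Proof.
move=> [_ rY] /card_gt0P[y /rY[T [T' [pS _ _]]]].
by rewrite (permP pS) !count_cat addnA leq_addl.
Qed.

Lemma grow_iter (V : finZmodType) (S : seq V) (l m K L B s t : nat) (Y : {set V}) U :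
  (0 < K)%N ->
  (forall t Y U, reach S t Y U -> (l <= #|Y|)%N -> (#|Y| < B)%N -> (m <= size U)%N ->
     exists Y' U', reach S t.+1 Y' U' /\ (K * #|Y| + L <= K * #|Y'|)%N) ->
  reach S t Y U -> (l <= #|Y|)%N -> (m + 2 * s <= size U)%N ->
  (K * B <= K * #|Y| + s * L)%N ->
  exists t' Y' U', [/\ reach S t' Y' U', (t' <= t + s)%N & (B <= #|Y'|)%N].
Proof.
move=> K0 grow; elim: s t Y U => [|s IH] t Y U rY lY mU KB.
  exists t, Y, U; split; rewrite ?addn0 //.
  by move: KB; rewrite addn0 leq_pmul2l.
have [YB|BY] := ltnP #|Y| B; last by exists t, Y, U; split; rewrite ?leq_addr.
have [|Y' [U' [rY' KY']]] := grow _ _ _ rY lY YB; first by lia.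
have YY' : (#|Y| <= #|Y'|)%N.
  by rewrite -(leq_pmul2l K0); apply: leq_trans KY'; apply: leq_addr.
have [|||t' [Y2 [U2 [r2 t2 B2]]]] := IH _ _ _ rY'.
- exact: leq_trans YY'.
- by case: rY rY' => [sS _] [sS' _]; lia.
- by move: KB KY'; rewrite mulSn; move: (K * _)%N (K * _)%N (K * _)%N (s * L)%N; lia.
by exists t', Y2, U2; split=> //; rewrite addnS -addSn.
Qed.

(** A nonzero column of the cokernel of the matrix of terms would be the normal of a hyperplane
    containing all of them. *)
Lemma spread_basis (p d : nat) (A : seq 'rV['F_p]_d.+1) :
  (forall u : 'rV['F_p]_d.+1, u != 0 -> ~~ all (fun x => dot u x == 0) A) ->
  exists2 M : 'M['F_p]_d.+1, M \in unitmx & forall i, row i M \in A.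
Proof.
move=> spread; pose X := \matrix_(i < size A) nth 0 A i.
have fX : row_full X.
  rewrite -cokermx_eq0; apply: contraT => /eqP K0.
  have [j uj] : exists j, (col j (cokermx X))^T != 0.
    apply: contra_notP K0 => no; apply/matrixP => i j; rewrite mxE.
    have [/rowP/(_ i)|nz] := eqVneq ((col j (cokermx X))^T) 0; first by rewrite !mxE.
    by case: no; exists j.
  have /allP[] := spread _ uj; move=> x /(nthP 0)[i iA <-].
  have := mulmx_coker X; move/matrixP/(_ (Ordinal iA) j); rewrite !mxE => E.
  rewrite dotE; apply/eqP; rewrite -[RHS]E; apply: eq_bigr => k _.
  by rewrite !mxE mulrC.
exists (rowsub (fullrankfun fX) X); first exact: fullrowsub_unit.
by move=> i; rewrite row_rowsub rowK mem_nth.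
Qed.

Definition spread (F : fieldType) (d h : nat) (S : seq 'rV[F]_d) : Prop :=
  forall u c, u != 0 -> (count (fun x => dot u x == c) S < h)%N.

Lemma pair_step (p d t : nat) (S U : seq 'rV['F_p]_d) (Y : {set 'rV['F_p]_d}) a b :
  reach S t Y (a :: U) -> b \in U ->
  exists Y' U', reach S t.+1 Y' U' /\ (#|Y'| = #|Y| + escape Y (b - a)%R)%N.
Proof.
move=> rY bU; exists ([set y + a | y in Y] :|: [set y + b | y in Y]), (rem b U).
split; last exact: card_sumset2.
by apply: reach_step rY _; rewrite perm_cons perm_to_rem.
Qed.

Lemma box_step (p d h t J : nat) (S U : seq 'rV['F_p]_d.+1) (Y : {set 'rV['F_p]_d.+1}) :
  prime p -> spread h S -> reach S t Y U -> (0 < #|Y|)%N -> (0 < h <= size U)%N ->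
  (J <= p)%N -> (4 * #|Y| <= J ^ d.+1)%N ->
  exists Y' U', reach S t.+1 Y' U' /\
    (4 * d.+1 * J * #|Y| + 3 * #|Y| <= 4 * d.+1 * J * #|Y'|)%N.
Proof.
move=> pp Sh rY Y0 /andP[h0 hU] Jp YJ.
have cU u c : u != 0 -> (count (fun x => dot u x == c) U < h)%N.
  by move=> u0; apply: leq_ltn_trans (reach_count _ rY Y0) (Sh _ _ u0).
case: U rY hU cU => [|a U] rY hU cU; first by rewrite leqNgt h0 in hU.
have [u u0|M uM MA] := @spread_basis p d [seq b - a | b <- U].
  apply/negP => aU; have := cU u (dot u a) u0.
  rewrite ltnNge (leq_trans hU) //= eqxx add1n ltnS.
  rewrite -[leqLHS](count_predT U).
  rewrite (@eq_in_count _ predT (fun x => dot u x == dot u a)) //.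
  move=> x xU; apply/esym; rewrite -subr_eq0 -dotBr.
  by apply: (allP aU); apply: (map_f (fun b => b - a)).
have [i Yi] := box_growth pp uM Jp YJ.
have /mapP[b bU Mi] := MA i; rewrite Mi in Yi.
have [Y' [U' [rY' Y'E]]] := pair_step rY bU; exists Y', U'; split=> //.
by rewrite Y'E mulnDr leq_add2l.
Qed.

Lemma hyperplane_step (p d h t J : nat) (S U : seq 'rV['F_p]_d.+1)
    (Y : {set 'rV['F_p]_d.+1}) :
  prime p -> spread h S -> reach S t Y U -> (0 < #|Y|)%N -> (1 < size U)%N ->
  (0 < J <= p)%N -> (4 * h * p <= J * (size U).-1)%N -> (2 * #|Y| <= p ^ d.+1)%N ->
  exists Y' U', reach S t.+1 Y' U' /\ (4 * J * #|Y| + #|Y| <= 4 * J * #|Y'|)%N.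
Proof.
move=> pp Sh rY Y0 U1 Jp hU Y2.
case: U rY U1 hU => // a U rY U1 hU.
have [u c u0||||b /mapP[x xU ->] Yb] :=
  @hyperplane_growth p d h J [seq b - a | b <- U] Y pp Jp.
- rewrite count_map; apply: ltnW; apply: leq_ltn_trans (Sh u (c + dot u a) u0).
  apply: leq_trans (reach_count _ rY Y0); rewrite /=; apply: leq_trans (leq_addl _ _).
  by apply: sub_count => y /=; rewrite dotBr subr_eq.
- by rewrite size_map.
- by rewrite size_map.
- exact: Y2.
have [Y' [U' [rY' Y'E]]] := pair_step rY xU; exists Y', U'; split=> //.
by rewrite Y'E mulnDr leq_add2l.
Qed.

(** The side J = 2^e of the box doubles repeatedly. At side J a step adds a proportion of order 1 /
    J, so C J steps reach the next size, and these numbers of steps add up geometrically. *)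
Lemma reach_constant_density (p d h : nat) (S : seq 'rV['F_p]_d.+1) (e : nat) :
  let C := (32 * d.+1 * 2 ^ d.+1)%N in
  prime p -> spread h S -> (0 < h)%N -> (2 ^ e <= p)%N ->
  (h + 2 * (C * 2 ^ e.+1) <= size S)%N ->
  exists t Y U, [/\ reach S t Y U, (t <= C * 2 ^ e.+1)%N & ((2 ^ e) ^ d.+1 < 4 * #|Y|)%N].
Proof.
move=> C pp Sh h0; elim: e => [|e IH] ep sS.
  by exists 0%N, [set 0], S; split; rewrite ?cards1 ?exp1n //; exact: reach0.
have ee : (2 ^ e.+1 = 2 * 2 ^ e)%N by rewrite expnS.
have ee' : (2 ^ e.+2 = 2 * 2 ^ e.+1)%N by rewrite expnS.
have [||t [Y [U [rY tC YL]]]] := IH.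
- by apply: leq_trans ep; rewrite leq_exp2l.
- apply: leq_trans sS.
  by rewrite leq_add2l leq_mul2l /= leq_mul2l leq_exp2l ?leqnSn ?orbT.
have Y0 : (0 < #|Y|)%N by move: YL; case: #|Y| => //; rewrite muln0 ltn0.
set J := (2 ^ e.+1)%N in ep ee ee' tC *; set L := ((2 ^ e) ^ d.+1)%N in YL.
have J0 : (0 < J)%N by rewrite expn_gt0.
have JL : (J ^ d.+1 = 2 ^ d.+1 * L)%N by rewrite ee expnMn.
have L0 : (0 < L)%N by rewrite !expn_gt0.
have [|t1 Y1 U1 rY1 lY1 Y1B hU1|||t' [Y' [U' [rY' t't Y'B]]]] := @grow_iter _ S #|Y| h
  (16 * d.+1 * J)%N L (J ^ d.+1 %/ 4).+1 (C * J)%N t Y U _ _ rY (leqnn _).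
- by rewrite !muln_gt0.
- have [|||Y2 [U2 [rY2 Y2E]]] := box_step (J := J) pp Sh rY1 _ _ ep.
  + exact: leq_trans lY1.
  + by rewrite h0.
  + by move: Y1B; rewrite ltnS leq_divRL // mulnC.
  exists Y2, U2; split=> //.
  have {}Y2E := leq_mul (leqnn 4) Y2E; rewrite mulnDr !mulnA in Y2E.
  apply: leq_trans Y2E; rewrite -!mulnA leq_add2l mulnA.
  move: YL lY1; move: #|_| #|_| => n n1; lia.
- have : size S = (2 * t + size U)%N by case: rY.
  by move: sS tC; rewrite ee'; move: (size S) (size U) => m n; lia.
- apply: leq_trans (leq_addl _ _).
  have -> : (C * J * L = 16 * d.+1 * J * (2 * J ^ d.+1))%N by rewrite JL /C; lia.
  rewrite leq_mul2l; apply/orP; right; have : (0 < J ^ d.+1)%N by rewrite expn_gt0 J0.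
  by have := leq_div (J ^ d.+1) 4; lia.
exists t', Y', U'; split=> //.
  by apply: leq_trans t't _; rewrite ee'; lia.
by move: Y'B; rewrite ltn_divLR // mulnC.
Qed.

(* reach_constant_density yields 4 * #|Y| >= (p / k) ^ d.+1; from there on, about
   p / 4 applications of hyperplane_step, each adding at least a proportion
   16 * k ^ d.+1 / p of #|Y|, suffice. *)
Lemma half_cover (d : nat) : exists p0 W : nat, (0 < W)%N /\
  forall (p h : nat) (S : seq 'rV['F_p]_d.+1), (p0 <= p)%N -> prime p -> spread h S ->
    (0 < h)%N -> (p + W * h + 1 <= size S)%N ->
    exists t Y U, [/\ reach S t Y U, (2 * t <= p)%N & (p ^ d.+1 < 2 * #|Y|)%N].
Proof.
pose C := (32 * d.+1 * 2 ^ d.+1)%N; pose k := (16 * C)%N; pose kD := (k ^ d.+1)%N.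
have C0 : (0 < C)%N by rewrite !muln_gt0 expn_gt0.
have kD0 : (0 < kD)%N by rewrite expn_gt0 muln_gt0 C0.
exists (8 * C + 64 * kD)%N, (512 * kD)%N; split; first by rewrite muln_gt0.
move=> p h S p0p pp Sh h0 sS.
have C8 : (0 < 8 * C)%N by rewrite muln_gt0.
(* This choice keeps the first phase within p / 4 steps, as [C * 2 ^ e.+1] is at most p / 4, while
   [2 ^ e] remains above p / k. *)
pose e := trunc_log 2 (p %/ (8 * C)).
have e1 : (2 ^ e <= p %/ (8 * C))%N.
  by apply: trunc_logP => //; rewrite divn_gt0 //; lia.
have e2 : (p %/ (8 * C) < 2 ^ e.+1)%N by apply: trunc_log_ltn.
rewrite leq_divRL // in e1; rewrite ltn_divLR // in e2.
have pk : (p < 2 ^ e * k)%N by move: e2; rewrite (expnS 2 e) /k; lia.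
have h1 : (h <= 512 * kD * h)%N by rewrite leq_pmull // muln_gt0.
have [||t [Y [U [rY tC YL]]]] := @reach_constant_density p d h S e pp Sh h0.
- by apply: leq_trans e1; rewrite leq_pmulr.
- by move: e1 sS; rewrite (expnS 2 e) -/C; move: (size S) => m; lia.
rewrite -/C in tC.
have Y0 : (0 < #|Y|)%N by move: YL; case: #|Y| => //; rewrite muln0 ltn0.
pose J := (p %/ (64 * kD))%N.
have J0 : (0 < J)%N by rewrite divn_gt0 ?muln_gt0 //; lia.
have J1 : (J * (64 * kD) <= p)%N by rewrite -leq_divRL ?muln_gt0.
have J2 : (p < J.+1 * (64 * kD))%N by rewrite -ltn_divLR ?muln_gt0.
have pY : (p ^ d.+1 <= 4 * kD * #|Y|)%N.
  apply: leq_trans (_ : (2 ^ e * k) ^ d.+1 <= _)%N; first by rewrite leq_exp2r // ltnW.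
  by rewrite expnMn -/kD mulnC -mulnA mulnCA leq_mul2l ltnW ?orbT.
have pD : (1 < p ^ d.+1)%N by rewrite -(exp1n d.+1) ltn_exp2r // prime_gt1.
have [|t1 Y1 U1 rY1 lY1 Y1B hU1|||t' [Y' [U' [rY' t't Y'B]]]] := @grow_iter _ S #|Y|
  (512 * kD * h + 1)%N (16 * kD * J)%N (p ^ d.+1) (p ^ d.+1 %/ 2).+1 (16 * kD * J)%N t Y U
  _ _ rY (leqnn _).
- by rewrite !muln_gt0 kD0.
- have [|||||Y2 [U2 [rY2 Y2E]]] := hyperplane_step (J := J) pp Sh rY1.
  + exact: leq_trans lY1.
  + by apply: leq_trans hU1; lia.
  + by rewrite J0; apply: leq_trans J1; rewrite leq_pmulr // muln_gt0.
  + apply: leq_trans (_ : J * (512 * kD * h) <= _)%N; last first.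
      by rewrite leq_mul2l; move: (size _) hU1 => m; lia.
    have : (p <= J * (128 * kD))%N by nia.
    by move=> /(leq_mul (leqnn (4 * h))); lia.
  + by move: Y1B; rewrite ltnS leq_divRL // mulnC.
  exists Y2, U2; split=> //.
  have {}Y2E := leq_mul (leqnn (4 * kD)) Y2E; rewrite mulnDr !mulnA in Y2E.
  have -> : (16 * kD * J = 4 * kD * 4 * J)%N by lia.
  apply: leq_trans Y2E; rewrite leq_add2l; apply: leq_trans pY _.
  by rewrite leq_mul2l lY1 orbT.
- have : size S = (2 * t + size U)%N by case: rY.
  move: e1 tC J1 sS; rewrite (expnS 2 e); move: (size S) (size U) => m n.
  by generalize (2 ^ e)%N kD C J => E k1 C1 J3; lia.
- apply: leq_trans (leq_addl _ _); rewrite leq_mul2l.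
  by rewrite ltn_divLR // ltn_Pmulr ?orbT // ltnW.
exists t', Y', U'; split=> //.
  by move: e1 tC t't; rewrite (expnS 2 e); lia.
by move: Y'B; rewrite ltn_divLR // mulnC.
Qed.

(** * The Alon-Dubiner theorem for primes and for all moduli *)

Lemma sumset_full (V : finZmodType) (A B : {set V}) (z : V) :
  (#|{: V}| < #|A| + #|B|)%N -> exists a b, [/\ a \in A, b \in B & a + b = z].
Proof.
move=> cAB; pose B' := [set z - b | b in B].
have cB' : #|B'| = #|B| by rewrite card_imset //; apply: can_inj (subKr z).
have /set0Pn[a] : A :&: B' != set0.
  rewrite -card_gt0 -(ltn_add2l #|A :|: B'|) addn0 cardsUI cB'.
  by apply: leq_ltn_trans cAB; apply: max_card.
by rewrite inE => /andP[aA /imsetP[b bB aE]]; exists a, b; split; rewrite // aE subrK.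
Qed.

Lemma pigeonhole_mult (T : finType) (m : nat) (S : seq T) :
  (m * #|T| < size S)%N -> exists x, (m < count_mem x S)%N.
Proof.
move=> ltS; apply/existsP; apply: contraLR ltS; rewrite -leqNgt => /existsPn Sx.
have -> : size S = (\sum_(x : T) count_mem x S)%N.
  elim: (S) => [|y s IHs] /=; first by rewrite big1.
  rewrite big_split /= -IHs (bigD1 y) //= eqxx big1 ?addn0 // => i.
  by rewrite eq_sym => /negPf ->.
rewrite mulnC -sum_nat_const; apply: leq_sum => x _.
by rewrite leqNgt.
Qed.

Lemma zsub_nseq (V : nmodType) (Z : pred V) L (S : seq V) x :
  (L <= count_mem x S)%N -> Z (x *+ L) -> zsub Z L S.
Proof.
move=> LS Zx.
have /(count_subseqP (nseq L x) S).1 [s' ss' ps'] :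
    forall y, (count_mem y (nseq L x) <= count_mem y S)%N.
  by move=> y; rewrite count_nseq /=; case: eqP => [<-|_]; rewrite ?mul0n ?mul1n.
have [U pU] := perm_to_subseq ss'.
exists (nseq L x), U; split; last 2 first.
- exact: size_nseq.
- by rewrite big_nseq iter_addr_0.
by rewrite (perm_trans pU) // perm_cat2r perm_sym.
Qed.

Lemma zall_pigeonhole (p d : nat) : prime p ->
  zall (fun x : 'rV['F_p]_d => x == 0) p (p.-1 * p ^ d + 1).
Proof.
move=> pp S pS; have p0 := prime_gt0 pp.
have [|x Sx] := @pigeonhole_mult _ p.-1 S.
  by rewrite card_mx mul1n card_Fp // -addn1.
apply: (@zsub_nseq _ _ _ _ x); first by apply: leq_trans Sx; rewrite prednK.
by apply/eqP/rowP => i; rewrite mulmxnE mxE -mulr_natr pchar_Fp_0 ?mulr0.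
Qed.

Lemma alon_dubiner_prime (d : nat) : exists c : nat, (0 < c)%N /\
  forall p, prime p -> zall (fun x : 'rV['F_p]_d => x == 0) p (c * p).
Proof.
elim: d => [|d [c' [c'0 IH]]].
  exists 1%N; split=> // p pp S; rewrite mul1n => pS.
  exists (take p S), (drop p S); rewrite cat_take_drop size_take_min; split=> //.
    exact/minn_idPl.
  by apply/eqP/rowP => -[].
have [p0 [W [W0 half]]] := half_cover d.
exists (p0 ^ d.+1 + 4 + W * c')%N; split; first by lia.
move=> p pp S pS; have p0' := prime_gt0 pp.
have [pp0|p0p] := ltnP p p0.
  (* For small primes the summand [p0 ^ d.+1] of the constant covers the pigeonhole bound. *)
  apply: (zall_pigeonhole pp (S := S)); apply: leq_trans pS.
  have : (p ^ d.+1 <= p0 ^ d.+1)%N by rewrite leq_exp2r // ltnW.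
  by nia.
case: (pselect (exists (u : 'rV['F_p]_d.+1) c,
    u != 0 /\ (c' * p <= count (fun x => dot u x == c) S)%N)).
  move=> [u [c [u0 cS]]].
  have [i ui] := rV_neq0 u0.
  pose H x := dot u x == c.
  have pf : perm_eq S (filter H S ++ filter (predC H) S) by rewrite perm_sym perm_filterC.
  apply: zsub_catl pf _.
  (* The sum of p terms with [dot u x = c] has [dot] equal to p c = 0, so it suffices that the
     remaining coordinates sum to 0. *)
  apply: (@zsub_map _ _ (col' i) _ (fun x : 'rV['F_p]_d => x == 0)); last first.
    by apply: IH => //; rewrite size_map size_filter.
  move=> s sH sp; rewrite big_map -[X in X == 0](raddf_sum (col' i)) => /eqP s0.
  apply/eqP; apply: (dot_col'_eq0 ui _ s0).
  have -> : dot u (\sum_(x <- s) x) = \sum_(x <- s) dot u x.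
    elim: (s) => [|x s' IHs]; last by rewrite !big_cons dotDr IHs.
    by rewrite !big_nil /dot trmx0 mulmx0 mxE.
  rewrite (eq_big_seq (fun=> c)) => [|x /sH]; last by rewrite mem_filter => /andP[/eqP].
  by rewrite big_const_seq count_predT sp iter_addr_0 -mulr_natr pchar_Fp_0 ?mulr0.
move=> no; have Sh : spread (c' * p) S.
  by move=> u c u0; rewrite ltnNge; apply/negP => cS; apply: no; exists u, c.
have {}pS : (4 * p + W * (c' * p) <= size S)%N.
  by apply: leq_trans pS; rewrite mulnA -mulnDl leq_mul2r; lia.
have h0 : (0 < c' * p)%N by rewrite muln_gt0 c'0.
have [|t1 [Y1 [U1 [r1 tp1 c1]]]] := half _ _ _ p0p pp Sh h0.
  by apply: leq_trans pS; lia.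
have Sh1 : spread (c' * p) U1.
  move=> u c u0; apply: leq_ltn_trans (reach_count _ r1 _) (Sh u c u0).
  by move: c1; case: #|_| => //; rewrite muln0 ltn0.
have sU1 : size S = (2 * t1 + size U1)%N by case: r1.
have [|t2 [Y2 [U2 [r2 tp2 c2]]]] := half _ _ _ p0p pp Sh1 h0.
  by move: pS sU1; move: (size S) (size U1) => m n; lia.
have sU2 : size U1 = (2 * t2 + size U2)%N by case: r2.
(* [w] further terms bring the length to [p]. Since [Y1] and [Y2] each fill more than half of the
   space, the negative of the sum of these terms lies in Y1 + Y2. *)
pose w := (p - t1 - t2)%N.
have sw : size (take w U2) = w.
  rewrite size_take_min; apply/minn_idPl; rewrite /w.
  by move: pS sU1 sU2; move: (size S) (size U1) (size U2) => m n n'; lia.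
have [|a [b [aY bY abE]]] := @sumset_full _ Y1 Y2 (- \sum_(x <- take w U2) x).
  by rewrite card_mx mul1n card_Fp //; move: c1 c2; move: #|_| #|_| => ? ?; lia.
have [T1 [T1' [p1 s1 e1]]] := r1.2 _ aY.
have [T2 [T2' [p2 s2 e2]]] := r2.2 _ bY.
exists (T1 ++ T2 ++ take w U2), (T1' ++ T2' ++ drop w U2); split.
- rewrite (perm_trans p1) // (@perm_trans _ (T1 ++ T1' ++ T2 ++ T2' ++ U2)) //.
    by rewrite !perm_cat2l.
  apply/permP => P; rewrite !count_cat -[in X in X = _](cat_take_drop w U2) count_cat.
  lia.
- by rewrite !size_cat s1 s2 sw /w; lia.
- by rewrite !big_cat /= e1 e2 addrA abE addNr.
Qed.

(** The smallest prime factor p of m = p m' is split off by [zall_comp], which reproduces the form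
    of the bound: p c (m' - 1) + c (p - 1) + 1 = c (p m' - 1) + 1. *)
Lemma zall_primes (r c m : nat) : (0 < m)%N ->
  (forall p, prime p -> p %| m -> zall (@dvdv r p) p (c * p.-1 + 1))%N ->
  zall (@dvdv r m) m (c * m.-1 + 1).
Proof.
move=> m0; elim/ltn_ind: m m0 => m IH m0 Zp.
have [m1|m1] := leqP m 1.
  have -> : m = 1%N by lia.
  move=> [|x S]; first by rewrite addn1.
  move=> _; exists [:: x], S; split=> //.
  by apply/dvdvP => j; rewrite dvd1n.
have pp := pdiv_prime m1; set p := pdiv m in pp; have p1 := prime_gt1 pp.
have mE : (m = p * (m %/ p))%N by rewrite mulnC divnK // pdiv_dvd.
have m'0 : (0 < m %/ p)%N by rewrite divn_gt0 ?pdiv_leq //; lia.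
have Zm' : zall (@dvdv r (m %/ p)) (m %/ p) (c * (m %/ p).-1 + 1).
  apply: IH => //; first by rewrite ltn_Pdiv.
  by move=> q pq qm; apply: Zp => //; rewrite mE dvdn_mull.
have := zall_comp (prime_gt0 pp) (Zp p pp (pdiv_dvd m)) Zm'; rewrite -mE.
have [k kE] : {k | (m %/ p)%N = k.+1} by exists (m %/ p).-1; rewrite prednK.
have [p' pE] : {p' | p = p'.+1} by exists p.-1; rewrite prednK // prime_gt0.
apply: zall_leq; rewrite {2}mE kE pE !addn1 /=.
by rewrite addnS ltnS mulnCA -mulnDr leq_mul2l; apply/orP; right; lia.
Qed.

Lemma alon_dubiner (r : nat) : exists c : nat,
  forall m, (0 < m)%N -> zall (@dvdv r m) m (c * m).
Proof.
(* The factor 2 gives c p <= 2 c (p - 1), which is the form propagated by [zall_primes]. *)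
have [c [c0 cP]] := alon_dubiner_prime r; exists (2 * c)%N => m m0.
apply: (@zall_leq _ _ _ (2 * c * m.-1 + 1)).
  by rewrite -{2}(prednK m0) mulnS addnC leq_add2r muln_gt0.
apply: zall_primes => // p pp _; apply: (@zall_leq _ _ _ (c * p)).
  by have := prime_gt1 pp; case: p {pp} => [|[|p]] //= _; lia.
exact: zall_Fp pp (cP p pp).
Qed.

(** * Polynomial functions of bounded degree *)

(* [dlt n f]: all n-th differences of f vanish, i.e. f is a polynomial function
   of degree less than n. *)
Fixpoint dlt (V : nmodType) (R : zmodType) (n : nat) (f : V -> R) : Prop :=
  if n is n'.+1 then forall v, dlt n' (fun x => f (x + v) - f x)
  else forall x, f x = 0.

Lemma eq_dlt (V : nmodType) (R : zmodType) n (f g : V -> R) :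
  f =1 g -> dlt n f -> dlt n g.
Proof.
elim: n f g => [|n IH] f g fg /= df; first by move=> x; rewrite -fg.
by move=> v; apply: IH (df v) => x; rewrite !fg.
Qed.

Lemma dlt0 (V : nmodType) (R : zmodType) n : dlt n (fun _ : V => 0 : R).
Proof.
elim: n => [|n IH] //= v; apply: eq_dlt IH => x; by rewrite subrr.
Qed.

Lemma dltS (V : nmodType) (R : zmodType) n (f : V -> R) : dlt n f -> dlt n.+1 f.
Proof.
elim: n f => [|n IH] f df v; last exact: IH (df v).
by move=> x; rewrite !df subrr.
Qed.

Lemma dlt_leq (V : nmodType) (R : zmodType) m n (f : V -> R) :
  (m <= n)%N -> dlt m f -> dlt n f.
Proof. by move=> /subnK <-; elim: (n - m)%N => // k IH /IH /dltS. Qed.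

Lemma dltD (V : nmodType) (R : zmodType) n (f g : V -> R) :
  dlt n f -> dlt n g -> dlt n (fun x => f x + g x).
Proof.
elim: n f g => [|n IH] f g /= df dg; first by move=> x; rewrite df dg addr0.
move=> v; apply: eq_dlt (IH _ _ (df v) (dg v)) => x /=.
by rewrite opprD addrACA.
Qed.

Lemma dlt_sum (V : nmodType) (R : zmodType) n (I : finType) (f : I -> V -> R) :
  (forall i, dlt n (f i)) -> dlt n (fun x => \sum_i f i x).
Proof.
move=> df; elim: (index_enum I) => [|i s IH].
  by apply: eq_dlt (dlt0 V R n) => x; rewrite big_nil.
by apply: eq_dlt (dltD (df i) IH) => x; rewrite big_cons.
Qed.

Lemma dltZ (V : nmodType) (R : pzRingType) n a (f : V -> R) :
  dlt n f -> dlt n (fun x => a * f x).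
Proof.
elim: n f => [|n IH] f /= df; first by move=> x; rewrite df mulr0.
by move=> v; apply: eq_dlt (IH _ (df v)) => x; rewrite mulrBr.
Qed.

Lemma dlt_shift (V : nmodType) (R : zmodType) n (f : V -> R) w :
  dlt n f -> dlt n (fun x => f (x + w)).
Proof.
elim: n f => [|n IH] f /= df; first by move=> x.
by move=> v; apply: eq_dlt (IH _ (df v)) => x; rewrite addrAC.
Qed.

Lemma dlt_const (V : nmodType) (R : zmodType) (c : R) : dlt 1 (fun _ : V => c).
Proof. by move=> v x; rewrite subrr. Qed.

Lemma dltM (V : nmodType) (R : comPzRingType) m n (f g : V -> R) :
  dlt m.+1 f -> dlt n.+1 g -> dlt (m + n).+1 (fun x => f x * g x).
Proof.
have [k mn] : {k | k = (m + n)%N} by exists (m + n)%N.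
rewrite -mn; elim: k m n mn f g => [|k IH] m n mn f g df dg v.
  have [m0 n0] : m = 0%N /\ n = 0%N by lia.
  subst m n; move=> x; move: (df v x) (dg v x) => /= /eqP; rewrite subr_eq0 => /eqP ->.
  by move=> /eqP; rewrite subr_eq0 => /eqP ->; rewrite subrr.
(* The discrete Leibniz rule; each summand has total degree one less. *)
apply: (@eq_dlt V R k.+1
  (fun x => (f (x + v) - f x) * g (x + v) + f x * (g (x + v) - g x))).
  by move=> x; ring.
apply: dltD.
  case: m mn df => [|m] mn df; last by apply: IH (df v) (dlt_shift v dg); lia.
  by apply: eq_dlt (dlt0 V R _) => x; rewrite df mul0r.
case: n mn dg => [|n] mn dg; last by apply: IH df (dg v); lia.
by apply: eq_dlt (dlt0 V R _) => x; rewrite dg mulr0.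
Qed.

Lemma dlt_prod (V : nmodType) (R : comPzRingType) (I : Type) (s : seq I) d
    (f : I -> V -> R) :
  (forall i, dlt d.+1 (f i)) -> dlt (size s * d).+1 (fun x => \prod_(i <- s) f i x).
Proof.
move=> df; elim: s => [|i s IH].
  by move=> v x; rewrite !big_nil subrr.
by rewrite mulSn; apply: (eq_dlt _ (dltM (df i) IH)) => x; rewrite big_cons.
Qed.

(** By Vandermonde's identity a difference of this binomial is a combination of lower ones with
    constant coefficients, in any characteristic. *)
Lemma dlt_bin (V : nmodType) (R : pzRingType) (l : V -> nat) s :
  {morph l : x y / x + y >-> (x + y)%N} -> dlt s.+1 (fun x => 'C(l x, s)%:R : R).
Proof.
move=> lD; elim/ltn_ind: s => s IH v.
apply: (@eq_dlt _ _ _ (fun x => \sum_(i < s) 'C(l v, s - i)%:R * 'C(l x, i)%:R)).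
  move=> x; rewrite lD -binomial.Vandermonde big_ord_recr /= subnn bin0 muln1 natrD addrK.
  by rewrite natr_sum; apply: eq_bigr => i _; rewrite mulnC natrM.
apply: dlt_sum => i; apply: dltZ; apply: (@dlt_leq _ _ i.+1) => //.
exact: IH.
Qed.

(* The alternating sum of f over all subsequence sums of S is an iterated
   difference of f, so it vanishes and f 0 must be cancelled by another term. *)
Lemma dlt_subsum (V : nmodType) (R : zmodType) (S : seq V) (f : V -> R) :
  dlt (size S) f -> f 0 != 0 ->
  exists T U, [/\ perm_eq S (T ++ U), T != [::] & f (\sum_(x <- T) x) != 0].
Proof.
move=> dS f0; apply: contrapT => no; case/eqP: f0.
have {no} : forall T U, perm_eq S (T ++ U) -> T != [::] -> f (\sum_(x <- T) x) = 0.
  by move=> T U pS T0; apply/eqP; apply: contraT => fT; case: no; exists T, U.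
elim: S f dS => [|v S IH] f dS fT; first exact: dS.
have fv : f v = 0 by have := fT [:: v] S; rewrite big_seq1; apply.
suff : f (0 + v) - f 0 = 0 by rewrite add0r fv sub0r => /eqP; rewrite oppr_eq0 => /eqP.
apply: (IH (fun x => f (x + v) - f x)); first exact: dS.
move=> T U pS T0; rewrite -[X in X + v]add0r (fT T (v :: U)) //; last first.
  by rewrite perm_sym -cat1s perm_catCA /= perm_cons perm_sym.
rewrite subr0 add0r (_ : _ + v = \sum_(x <- v :: T) x); last by rewrite big_cons addrC.
apply: (fT (v :: T) U) => //=.
by rewrite perm_cons.
Qed.

(** * Binomial coefficients modulo p and zero-sum lengths *)

Lemma dvdn_bin_ppow (p a i : nat) : prime p -> (0 < i < p ^ a)%N -> (p %| 'C(p ^ a, i))%N.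
Proof.
move=> pp /andP[i0 iq]; apply: contraT => np.
have : (p ^ a %| i * 'C(p ^ a, i))%N.
  by case: i i0 iq np => // i _ _ _; rewrite -mul_bin_diag dvdn_mulr.
rewrite Gauss_dvdl; last by rewrite coprimeXl // prime_coprime.
by move=> /(dvdn_leq i0); rewrite leqNgt iq.
Qed.

Lemma bin_ppowD (p a x s : nat) : prime p -> (s < p ^ a)%N ->
  'C(x + p ^ a, s)%:R = 'C(x, s)%:R :> 'F_p.
Proof.
move=> pp sq; rewrite addnC -binomial.Vandermonde big_ord_recl bin0 mul1n subn0.
rewrite natrD natr_sum big1 ?addr0 // => i _.
apply/eqP; rewrite -(dvdn_pcharf (pchar_Fp pp)) dvdn_mulr // dvdn_bin_ppow //.
by rewrite lift0 /=; have := ltn_ord i; lia.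
Qed.

(** A case of Lucas's theorem: only the two extreme terms of Vandermonde's sum survive modulo p, so
    each further [p ^ a] adds 1. *)
Lemma bin_ppowM (p a j : nat) : prime p -> 'C(j * p ^ a, p ^ a)%:R = j%:R :> 'F_p.
Proof.
move=> pp; have q0 : (0 < p ^ a)%N by rewrite expn_gt0 prime_gt0.
elim: j => [|j IH]; first by rewrite mul0n bin_small.
rewrite mulSn -binomial.Vandermonde big_ord_recl bin0 mul1n subn0.
case: (p ^ a)%N q0 (fun i => @dvdn_bin_ppow p a i pp) IH => // q _ qdvd IH.
rewrite big_ord_recr /= /bump leq0n add1n binn subnn bin0 muln1 !natrD IH.
rewrite natr_sum big1 ?add0r.
  by rewrite -[RHS]natr1.
move=> i _; apply/eqP; rewrite -(dvdn_pcharf (pchar_Fp pp)) dvdn_mulr // qdvd //.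
exact: (ltn_ord i).
Qed.

(** The expansion of (1 - 1)^x truncated at degree q - 1. For q a power of p its binomials have
    period q modulo p, which makes it the indicator of q | x. *)
Definition dvd_indic (p q : nat) (x : nat) : 'F_p := \sum_(s < q) (-1) ^+ s * 'C(x, s)%:R.

Lemma dvd_indicE (p a x : nat) : prime p -> dvd_indic p (p ^ a) x = (p ^ a %| x)%N%:R.
Proof.
move=> pp; have q0 : (0 < p ^ a)%N by rewrite expn_gt0 prime_gt0.
rewrite (divn_eq x (p ^ a)) dvdn_addr ?dvdn_mull //.
elim: (x %/ p ^ a)%N => [|y IH]; last first.
  rewrite -[RHS]IH mulSn -addnA addnC; apply: eq_bigr => s _.
  by rewrite bin_ppowD.
rewrite mul0n add0n; have := ltn_pmod x q0; set z := (x %% _)%N => zq.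
rewrite /dvd_indic -(big_mkord xpredT (fun s => (-1) ^+ s * 'C(z, s)%:R)).
rewrite (big_cat_nat _ zq) //= [X in _ + X]big_nat [X in _ + X]big1 ?addr0; last first.
  by move=> i /andP[zi _]; rewrite bin_small ?mulr0.
transitivity ((1 - 1 : 'F_p) ^+ z).
  rewrite exprBn big_mkord; apply: eq_bigr => i _.
  by rewrite !expr1n !mulr1 mulr_natr.
rewrite subrr expr0n; congr (nat_of_bool _)%:R.
have [->|z0] := eqVneq z 0%N; first by rewrite dvdn0.
by rewrite gtnNdvd // lt0n.
Qed.

Lemma dlt_comp (V W : nmodType) (R : zmodType) (h : V -> W) n (g : W -> R) :
  {morph h : x y / x + y} -> dlt n g -> dlt n (g \o h).
Proof.
move=> hD; elim: n g => [|n IH] g /= dg; first by move=> x.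
by move=> v; apply: eq_dlt (IH _ (dg (h v))) => x; rewrite /= hD.
Qed.

Lemma dlt_dvd_indic (p q : nat) : (0 < q)%N -> dlt q.-1.+1 (dvd_indic p q : nat -> 'F_p).
Proof.
move=> q0; rewrite prednK //; apply: dlt_sum => s; apply: dltZ.
by apply: (dlt_leq (ltn_ord s)); apply: dlt_bin.
Qed.

(** The length is recorded as an extra coordinate, equal to 1 on each term. The product of r
    indicators of degree q - 1 and of [g] has degree below the number of terms, so [dlt_subsum]
    applies. *)
Lemma zero_sum_length (p a r d : nat) (g : nat -> 'F_p) (S : seq 'rV[nat]_r) :
  prime p -> dlt d.+1 g -> g 0%N != 0 -> (r * (p ^ a).-1 + d < size S)%N ->
  exists T U, [/\ perm_eq S (T ++ U), T != [::], dvdv (p ^ a) (\sum_(x <- T) x)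
    & g (size T) != 0].
Proof.
move=> pp dg g0 sS; have q0 : (0 < p ^ a)%N by rewrite expn_gt0 prime_gt0.
pose V : nmodType := ('rV[nat]_r * nat)%type.
pose f (z : V) : 'F_p :=
  (\prod_(c <- enum 'I_r) dvd_indic p (p ^ a) (z.1 ord0 c)) * g z.2.
have df : dlt (r * (p ^ a).-1 + d).+1 f.
  apply: dltM; last by apply: (dlt_comp (h := fun z : V => z.2)) dg.
  rewrite -{1}(size_enum_ord r); apply: dlt_prod => c.
  apply: (dlt_comp (h := fun z : V => z.1 ord0 c)) (dlt_dvd_indic p q0) => x y.
  by rewrite /= mxE.
pose S' : seq V := [seq (x, 1%N) | x <- S].
have [||T [U [pT T0 fT]]] := @dlt_subsum V 'F_p S' f.
- by apply: dlt_leq df; rewrite size_map.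
- rewrite mulf_neq0 // prodf_seq_neq0; apply/allP => c _ /=.
  by rewrite dvd_indicE // mxE dvdn0 oner_eq0.
have [S1 pS1 S1E] := perm_map_lift pT.
pose T1 := take (size T) S1.
have T1E : [seq (x, 1%N) | x <- T1] = T by rewrite map_take S1E take_size_cat.
have sumT : \sum_(x <- T) x = (\sum_(x <- T1) x, size T1).
  rewrite -T1E; elim: (T1) => [|x s IH]; first by rewrite !big_nil.
  by rewrite /= !big_cons IH.
move: fT; rewrite sumT /f mulf_eq0 negb_or prodf_seq_neq0 => /andP[/allP fT gT].
exists T1, (drop (size T) S1); split=> //.
- by rewrite cat_take_drop.
- by apply: contraNneq T0 => T1n; rewrite -T1E T1n.
apply/dvdvP => c; have := fT c; rewrite mem_enum => /(_ isT) /=.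
by rewrite dvd_indicE //; case: (_ %| _)%N; rewrite // eqxx.
Qed.

(** Here the condition on the length is divisibility by [Q]. After truncation to
    [Q + r * (p ^ a).-1] terms, fewer than 2 Q, the only positive multiple available is [Q]. *)
Lemma zall_ppow (p a b r : nat) : prime p -> (r <= p ^ b)%N ->
  zall (@dvdv r (p ^ a)) (p ^ (a + b)) (p ^ (a + b) + r * (p ^ a).-1).
Proof.
move=> pp rb; set Q := (p ^ (a + b))%N.
have q0 : (0 < p ^ a)%N by rewrite expn_gt0 prime_gt0.
have Q0 : (0 < Q)%N by rewrite expn_gt0 prime_gt0.
have rQ : (r * (p ^ a).-1 < Q)%N.
  apply: leq_ltn_trans (leq_mul rb (leqnn _)) _; rewrite /Q expnD mulnC ltn_pmul2r.
    by rewrite prednK.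
  by rewrite expn_gt0 prime_gt0.
move=> S tS; set t := (Q + _)%N in tS.
apply: (@zsub_catl _ _ _ _ (take t S) (drop t S)); first by rewrite cat_take_drop.
have st : size (take t S) = t by rewrite size_take_min (minn_idPl tS).
have [|||T [U [pT T0 ZT iT]]] :=
  @zero_sum_length p a r Q.-1 (dvd_indic p Q) (take t S) pp.
- exact: dlt_dvd_indic.
- by rewrite dvd_indicE // dvdn0 oner_eq0.
- by rewrite st /t; lia.
move: iT; rewrite dvd_indicE //.
case: (boolP (Q %| size T)%N) => [|_]; last by rewrite eqxx.
move=> /dvdnP[k kT] _; exists T, U; split=> //.
have tE : t = (size T + size U)%N by rewrite -st (perm_size_cat pT).
rewrite kT /t in tE; have k0 : (k != 0)%N.
  by apply: contraNneq T0 => k0; move: kT; rewrite k0 => /size0nil ->.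
case: k kT k0 tE => [|[|k]] // kT _ tE; first by rewrite kT mul1n.
by move: tE; rewrite !mulSn; lia.
Qed.

(* The factor \prod_(j <- P) ('C(l, q) - j) kills the lengths l = j q with j in P,
   since 'C(j q, q) = j modulo p. *)
Lemma zero_sum_avoid (p a r L : nat) (P : seq nat) (S : seq 'rV[nat]_r) :
  prime p -> (0 < r)%N -> (r + size P < L)%N -> all (fun j => ~~ (p %| j)%N) P ->
  (L * p ^ a <= size S)%N ->
  exists j, [/\ (0 < j < L)%N, j \notin P & zsub (@dvdv r (p ^ a)) (j * p ^ a) S].
Proof.
move=> pp r0 PL pP LS; set q := (p ^ a)%N in LS *.
have q0 : (0 < q)%N by rewrite expn_gt0 prime_gt0.
have Lq0 : (0 < L * q)%N by rewrite muln_gt0 q0; lia.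
(* One term fewer than L q, which forces j < L for the length j q found. *)
pose t := (L * q).-1; have tS : (t <= size S)%N by rewrite /t; lia.
have st : size (take t S) = t by rewrite size_take_min (minn_idPl tS).
pose g l : 'F_p := dvd_indic p q l * \prod_(j <- P) ('C(l, q)%:R - j%:R).
have [|||T [U [pT T0 ZT]]] := @zero_sum_length p a r (q.-1 + size P * q) g (take t S) pp.
- apply: dltM; first exact: dlt_dvd_indic.
  apply: dlt_prod => j; apply: dltD; first by apply: dlt_bin.
  by apply: (@dlt_leq _ _ 1) => //; apply: dlt_const.
- rewrite mulf_neq0 //; first by rewrite dvd_indicE // dvdn0 oner_eq0.
  rewrite prodf_seq_neq0; apply/allP => j /(allP pP) /=.
  by rewrite bin_small // sub0r oppr_eq0 (dvdn_pcharf (pchar_Fp pp)).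
(* The degree bound is (r + 1 + |P|) q - r - 1, which is below L q - 1 because r > 0. *)
- rewrite st /t -/q; have : ((r + size P).+1 * q <= L * q)%N by rewrite leq_mul2r PL orbT.
  move: (L * q)%N (size P) => M m; case: (q) q0 => // q' _ /=; nia.
rewrite /g mulf_eq0 negb_or dvd_indicE // -/q prodf_seq_neq0.
case: (boolP (q %| size T)%N) => [|_]; last by rewrite eqxx.
move=> /dvdnP[j jT] /andP[_ /allP jP]; exists j; split.
- have tE : t = (size T + size U)%N by rewrite -st (perm_size_cat pT).
  rewrite jT /t in tE.
  have jL : (j < L)%N by rewrite -(ltn_pmul2r q0); lia.
  rewrite jL andbT lt0n; apply: contraNneq T0 => j0.
  by move: jT; rewrite j0 => /size0nil ->.
- by apply/negP => /jP /=; rewrite jT bin_ppowM // subrr eqxx.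
apply: (@zsub_catl _ _ _ _ (take t S) (drop t S)); first by rewrite cat_take_drop.
by exists T, U.
Qed.

(** * Refuting missing lengths *)

Definition avoids (r q : nat) (S : seq 'rV[nat]_r) (F : seq nat) : Prop :=
  forall x, x \in F -> ~ zsub (@dvdv r q) (x * q) S.

Lemma avoids_rest (r q j : nat) (S T U : seq 'rV[nat]_r) (F : seq nat) :
  perm_eq S (T ++ U) -> size T = (j * q)%N -> dvdv q (\sum_(x <- T) x) ->
  avoids q S F -> avoids q U (F ++ [seq x - j | x <- F & j <= x])%N.
Proof.
move=> pS sT ZT SF x; rewrite mem_cat => /orP[xF|].
  move=> Ux; apply: (SF x xF); apply: zsub_catl Ux.
  by rewrite (perm_trans pS) // perm_catC.
move=> /mapP[y]; rewrite mem_filter => /andP[jy yF] -> [B [C [pU sB ZB]]].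
apply: (SF y yF); exists (T ++ B), C; split.
- by rewrite (perm_trans pS) // -catA perm_cat2l.
- by rewrite size_cat sT sB -mulnDl subnKC.
- by rewrite big_cat dvdvD.
Qed.

Lemma avoids_block (r q j : nat) (S T U : seq 'rV[nat]_r) (F : seq nat) :
  perm_eq S (T ++ U) -> size T = (j * q)%N -> dvdv q (\sum_(x <- T) x) ->
  avoids q S F -> avoids q T (F ++ [seq j - x | x <- F & x < j])%N.
Proof.
move=> pS sT ZT SF x; rewrite mem_cat => /orP[xF Tx|].
  by apply: (SF x xF); apply: zsub_catl pS Tx.
move=> /mapP[y]; rewrite mem_filter => /andP[yj yF] -> [B [C [pT sB ZB]]].
apply: (SF y yF); exists C, (B ++ U); split.
- by rewrite (perm_trans pS) // catA perm_cat2r (perm_trans pT) // perm_catC.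
- have := perm_size_cat pT; rewrite sT sB => sC.
  apply/eqP; rewrite -(eqn_add2l ((j - y) * q)) -sC -mulnDl subnK //.
  exact: ltnW.
apply/dvdvP => c; move/dvdvP/(_ c): ZT; rewrite (perm_big _ pT) big_cat mxE.
by rewrite dvdn_addr //; move/dvdvP: ZB.
Qed.

(* [refutes r fuel L F] implies that, when q is a power of a prime p >= 5, no
   sequence of length L q over C_q^r avoids zero-sum subsequences of the lengths
   x q, x in F.  If one of length j q is present, what remains of the sequence
   also avoids (x - j) q, and the subsequence itself avoids (j - x) q; lengths j
   that are refuted in this way are added to F.  5, 7 and 10 are the numbers up
   to 10 that may be divisible by such a p. *)
Fixpoint refutes (r fuel L : nat) (F : seq nat) : bool :=
  (0 \in F)%N || if fuel is fuel'.+1 then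
    let absent F j :=
      refutes r fuel' (L - j) (F ++ [seq x - j | x <- F & j <= x])%N ||
      refutes r fuel' j (F ++ [seq j - x | x <- F & x < j])%N in
    let F' := foldl (fun F j => if absent F j then j :: F else F) F
                (iota 1 L.-1 ++ iota 1 L.-1) in
    let P := [seq j <- iota 1 L.-1 | j \notin F'] in
    (r + size P < L)%N && all (fun j => j \in [:: 1; 2; 3; 4; 6; 8; 9]%N) P
  else false.

Lemma refutesP (p a r fuel L : nat) (F : seq nat) (S : seq 'rV[nat]_r) :
  prime p -> (5 <= p)%N -> (0 < r)%N -> refutes r fuel L F ->
  (L * p ^ a <= size S)%N -> ~ avoids (p ^ a) S F.
Proof.
move=> pp p5 r0; elim: fuel L F S => [|fuel IH] L F S /=.
  rewrite orbF => F0 _ /(_ _ F0); apply; exists [::], S.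
  by split; rewrite ?mul0n ?big_nil //; apply/dvdvP => c; rewrite mxE dvdn0.
move=> /orP[F0|ref] LS SF.
  apply: (SF _ F0); exists [::], S.
  by split; rewrite ?mul0n ?big_nil //; apply/dvdvP => c; rewrite mxE dvdn0.
move: ref; set F' := foldl _ _ _; set P := [seq _ <- _ | _] => /andP[PL okP].
have SF' : avoids (p ^ a) S F'.
  rewrite {PL okP P}/F'; elim: (_ ++ _) F SF => [|j s IHs] F SF //=.
  apply: IHs; case: ifP => // /orP absent x; rewrite inE => /predU1P[->|]; last exact: SF.
  move=> [T [U [pS sT ZT]]]; have := perm_size_cat pS; rewrite sT => sS.
  case: absent => ref.
    apply: (IH _ _ U ref); last exact: avoids_rest pS sT ZT SF.
    by rewrite mulnBl leq_subLR -sS.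
  by apply: (IH _ _ T ref); [rewrite sT | exact: avoids_block pS sT ZT SF].
(* All j with 0 < j < L outside [P] lie in [F'], so the length found here contradicts [SF']. *)
have [|j [jL jP Sj]] := @zero_sum_avoid p a r L P S pp r0 PL _ LS.
  apply/allP => j /(allP okP) jok; apply/negP => pj.
  have j10 : (j <= 9)%N by move: jok; rewrite !inE => /or4P[|||/or4P[]] /eqP ->.
  have := dvdn_leq _ pj; move: pj; have : (0 < j)%N by move: jok; case: (j).
  move=> j0 pj /(_ j0) pj'; have : (p <= 9)%N := leq_trans pj' j10.
  by case: (p) p5 pp pj => [|[|[|[|[|[|[|[|[|[|]]]]]]]]]] // _ _;
    move: jok; rewrite !inE => /or4P[|||/or4P[]] /eqP ->.
apply: (SF' j _ Sj); apply: contraNT jP => jF'.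
by rewrite mem_filter jF' mem_iota; case/andP: jL => -> /=; lia.
Qed.

Lemma zall_refutes (p a r fuel k : nat) : prime p -> (5 <= p)%N -> (0 < r)%N ->
  refutes r fuel (k + r) [:: k] ->
  zall (@dvdv r (p ^ a)) (k * p ^ a) (k * p ^ a + r * p ^ a).
Proof.
move=> pp p5 r0 ref S; rewrite -mulnDl => kS; apply: contrapT => no.
apply: (refutesP pp p5 r0 ref kS) => x; rewrite inE => /eqP ->; exact: no.
Qed.

(** The search settles k = 3, 4, 5; larger k are reached by adding 3. *)
Lemma zall_rank3_ge5 (p a k : nat) : prime p -> (5 <= p)%N -> (3 <= k)%N ->
  zall (@dvdv 3 (p ^ a)) (k * p ^ a) (k * p ^ a + 3 * p ^ a).
Proof.
move=> pp p5; elim/ltn_ind: k => k IH k3.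
have [k5|k5] := leqP k 5.
  apply: (@zall_refutes p a 3 3) => //.
  by have /or3P[/eqP->|/eqP->|/eqP->] : [|| k == 3, k == 4 | k == 5]%N by lia.
rewrite -(subnK k3) mulnDl; apply: zall_cat.
- by move=> x y; apply: dvdvD.
- by apply: IH; lia.
- by apply: IH; lia.
Qed.

Lemma zall_rank4_ge5 (p a k : nat) : prime p -> (5 <= p)%N -> (4 <= k)%N ->
  zall (@dvdv 4 (p ^ a)) (k * p ^ a) (k * p ^ a + 4 * p ^ a).
Proof.
move=> pp p5; elim/ltn_ind: k => k IH k4.
have [k7|k7] := leqP k 7.
  apply: (@zall_refutes p a 4 3) => //.
  have K4 : [|| k == 4, k == 5, k == 6 | k == 7]%N by lia.
  by case/or4P: K4 => /eqP ->.
rewrite -(subnK k4) mulnDl; apply: zall_cat.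
- by move=> x y; apply: dvdvD.
- by apply: IH; lia.
- by apply: IH; lia.
Qed.

(** * The primes 2 and 3 *)

(** Three distinct points of F_3^d form an affine line exactly when their sum is 0; sets without
    lines are cap sets. *)
Definition has_line (d : nat) (A : {set 'rV['F_3]_d}) : Prop :=
  exists x y z, [/\ [/\ x \in A, y \in A & z \in A], uniq [:: x; y; z] & x + y + z = 0].

Lemma proj_indic (p d : nat) (A : {set 'rV['F_p]_d}) u c :
  proj u (fun x => (x \in A)%:R) c = #|[set x in A | dot u x == c]|%:R :> int.
Proof.
rewrite /proj -sum_indic big_mkcond; apply: eq_bigr => x _.
by rewrite inE; case: (dot u x == c); rewrite ?andbT ?andbF.
Qed.

Lemma subset_card_eq (T : finType) (A : {set T}) n :
  (n <= #|A|)%N -> exists2 B : {set T}, B \subset A & #|B| = n.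
Proof.
move=> nA; exists [set x in take n (enum A)].
  by apply/subsetP => x; rewrite inE => /mem_take; rewrite mem_enum.
rewrite cardsE; apply/eqP; rewrite (card_uniqP _) ?take_uniq ?enum_uniq //.
by rewrite size_take_min -cardE (minn_idPl nA).
Qed.

(** The defects f - m_i are nonnegative, so their squares sum to at most the square of their sum. *)
Lemma sum_sqr_defect_le (R : realDomainType) (I : finType) (m : I -> R) (f : R) :
  (forall i, m i <= f) ->
  \sum_i m i ^+ 2 + 2 * f * (#|I|%:R * f - \sum_i m i) <=
    #|I|%:R * f ^+ 2 + (#|I|%:R * f - \sum_i m i) ^+ 2.
Proof.
move=> mf; pose y i := f - m i.
have y0 i : 0 <= y i by rewrite subr_ge0.
have sy : #|I|%:R * f - \sum_i m i = \sum_i y i.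
  by rewrite sumrB sumr_const mulr_natl.
have y2 : \sum_i y i ^+ 2 <= (\sum_i y i) ^+ 2.
  rewrite [leRHS]expr2 mulr_suml; apply: ler_sum => i _; rewrite expr2.
  by rewrite ler_wpM2l // (bigD1 i) //= lerDl sumr_ge0.
have -> : \sum_i m i ^+ 2 = \sum_i (f ^+ 2 - 2 * f * y i + y i ^+ 2).
  by apply: eq_bigr => i _; rewrite /y; ring.
rewrite sy big_split sumrB sumr_const -mulr_sumr /= -[X in X - _ + _]mulr_natl.
by rewrite addrAC subrK lerD2l.
Qed.

(* Meshulam's counting: averaged over the directions, the second moment of the
   hyperplane sections of A exceeds what sections of size at most f allow. *)
Lemma has_line_step (d f n : nat) :
  (forall A : {set 'rV['F_3]_d}, (f < #|A|)%N -> has_line A) -> (n <= 3 * f)%N ->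
  ((3 ^ d.+1).-1 * (3 * f ^ 2 + (3 * f - n) ^ 2) <
     (3 ^ d).-1 * n ^ 2 + 3 ^ d * 2 * n + (3 ^ d.+1).-1 * (2 * f * (3 * f - n)))%N ->
  forall A : {set 'rV['F_3]_d.+1}, (n <= #|A|)%N -> has_line A.
Proof.
move=> Hf n3f ineq A' nA'; have [A AA' An] := subset_card_eq nA'.
suff [x [y [z [[xA yA zA] u s]]]] : has_line A.
  by exists x, y, z; split=> //; split; apply: (subsetP AA').
apply: contrapT => noline.
(* The section embeds in dimension d by [col' i], and a line in the image lifts: its three points
   have [dot] sum 3 c = 0. *)
have sect u c : u != 0 -> (#|[set x in A | dot u x == c]| <= f)%N.
  move=> u0; rewrite leqNgt; apply/negP => fc; apply: noline.
  have [i ui] := rV_neq0 u0.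
  have inj : {in [set x in A | dot u x == c] &, injective (col' i)}.
    move=> x y; rewrite !inE => /andP[_ /eqP ux] /andP[_ /eqP uy] xy.
    apply/eqP; rewrite -subr_eq0; apply/eqP; apply: (dot_col'_eq0 ui).
      by rewrite dotBr ux uy subrr.
    by rewrite (raddfB (col' i)) /= xy subrr.
  have [|x' [y' [z' [[]]]]] := Hf (col' i @: [set x in A | dot u x == c]).
    by rewrite card_in_imset.
  move=> /imsetP[x xc ->] /imsetP[y yc ->] /imsetP[z zc ->] unq s0.
  exists x, y, z; split.
  - by move: xc yc zc; rewrite !inE => /andP[-> _] /andP[-> _] /andP[-> _].
  - by apply: (@map_uniq _ _ (col' i)).
  apply: (dot_col'_eq0 ui); last by rewrite !raddfD.
  move: xc yc zc; rewrite !inE !dotDr => /andP[_ /eqP ->] /andP[_ /eqP ->] /andP[_ /eqP ->].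
  by rewrite -mulr2n -mulrSr -mulr_natr pchar_Fp_0 ?mulr0.
pose F (x : 'rV['F_3]_d.+1) : int := (x \in A)%:R.
have := @sum_proj_sqr 'F_3 int d F.
have -> : \sum_x F x = n%:R by rewrite /F sum_indic An.
have -> : \sum_x F x ^+ 2 = n%:R.
  by rewrite -An -sum_indic; apply: eq_bigr => x _; rewrite /F; case: (x \in A).
rewrite card_Fp // => E.
pose sl : int := (3 * f - n)%:R.
have slE : sl = 3 * f%:R - n%:R by rewrite /sl natrB // natrM.
have up u : u != 0 -> \sum_c proj u F c ^+ 2 + 2 * f%:R * sl <= 3 * f%:R ^+ 2 + sl ^+ 2.
  move=> u0; have := @sum_sqr_defect_le int 'F_3 (proj u F) f%:R _.
  rewrite card_Fp // sum_proj /F sum_indic An -slE; apply => c.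
  by rewrite proj_indic ler_nat sect.
have cu : #|[pred u : 'rV['F_3]_d.+1 | u != 0]| = (3 ^ d.+1).-1.
  by rewrite (cardC1 (0 : 'rV['F_3]_d.+1)) card_mx mul1n card_Fp.
have : \sum_(u : 'rV['F_3]_d.+1 | u != 0) (\sum_c proj u F c ^+ 2 + 2 * f%:R * sl) <=
   \sum_(u : 'rV['F_3]_d.+1 | u != 0) (3 * f%:R ^+ 2 + sl ^+ 2) by apply: ler_sum.
rewrite big_split /= E !sumr_const cu -[X in _ + X]mulr_natl -[leRHS]mulr_natl.
rewrite /sl -!(natrX, natrM, natrD) ler_nat leqNgt => /negP; apply.
exact: ineq.
Qed.

Lemma has_line_dim1 (A : {set 'rV['F_3]_1}) : (2 < #|A|)%N -> has_line A.
Proof.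
move=> A2; have AT : A = setT.
  by apply/eqP; rewrite eqEcard subsetT cardsT card_mx card_Fp.
have AT' x : x \in A by rewrite AT.
exists 0, (const_mx 1), (const_mx 2); split=> //.
  by rewrite /= !inE !negb_or !andbT; apply/andP; split; [apply/andP; split|];
    apply/eqP => /rowP/(_ ord0); rewrite !mxE.
by apply/rowP => i; rewrite !mxE; apply/eqP.
Qed.

Lemma has_line_dim2 (A : {set 'rV['F_3]_2}) : (4 < #|A|)%N -> has_line A.
Proof. by apply: (has_line_step (f := 2) has_line_dim1). Qed.

Lemma has_line_dim3 (A : {set 'rV['F_3]_3}) : (9 < #|A|)%N -> has_line A.
Proof. by apply: (has_line_step (f := 4) has_line_dim2). Qed.

Lemma has_line_dim4 (A : {set 'rV['F_3]_4}) : (23 < #|A|)%N -> has_line A.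
Proof. by apply: (has_line_step (f := 9) has_line_dim3). Qed.

(** Either some vector occurs three times, or 2 f + 1 terms have more than f distinct values and a
    line among them. *)
Lemma zall_has_line (d f : nat) :
  (forall A : {set 'rV['F_3]_d}, (f < #|A|)%N -> has_line A) ->
  zall (fun x : 'rV['F_3]_d => x == 0) 3 (2 * f + 1).
Proof.
move=> Hf S fS.
have [[x x3]|no] := pselect (exists x, (2 < count_mem x S)%N).
  apply: (@zsub_nseq _ _ _ _ x) => //.
  by apply/eqP/rowP => i; rewrite mulmxnE mxE -mulr_natr pchar_Fp_0 ?mulr0.
have [|x [y [z [[xS yS zS] u s0]]]] := Hf [set x in S].
  have -> : #|[set x in S]| = size (undup S).
    by rewrite -(card_uniqP (undup_uniq S)) cardsE; apply: eq_card => x; rewrite mem_undup.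
  rewrite -(ltn_pmul2l (m := 2)) //; apply: leq_trans (_ : size S <= _)%N; first by lia.
  rewrite -(perm_size (perm_count_undup S)) size_flatten sumnE !big_map.
  rewrite -sum1_size big_distrr /=; apply: leq_sum => x _.
  by rewrite size_nseq muln1 leqNgt; apply/negP => x3; apply: no; exists x.
have sub : {subset [:: x; y; z] <= S}.
  by move=> w; rewrite !inE in xS yS zS *; move=> /or3P[] /eqP ->.
have /(count_subseqP [:: x; y; z] S).1 [s' ss' ps'] := leq_uniq_count u sub.
have [U pU] := perm_to_subseq ss'.
exists [:: x; y; z], U; split=> //.
  by rewrite (perm_trans pU) // perm_cat2r perm_sym.
by rewrite !big_cons big_nil addr0 addrA s0.
Qed.

(** The bound 2 * 9 + 1 for the prime 3 is 9 (3 - 1) + 1, the form carried over to powers. *)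
Lemma zall_rank3_pow3 (a : nat) : zall (@dvdv 3 (3 ^ a)) (3 ^ a) (9 * (3 ^ a).-1 + 1).
Proof.
apply: zall_primes; first by rewrite expn_gt0.
move=> p pp; rewrite Euclid_dvdX // => /andP[]; rewrite dvdn_prime2 // => /eqP -> _.
apply: (@zall_leq _ _ _ (2 * 9 + 1)) => //.
by apply: zall_Fp => //; apply: zall_has_line has_line_dim3.
Qed.

Lemma zall_rank4_pow3 (a : nat) : zall (@dvdv 4 (3 ^ a)) (3 ^ a) (23 * (3 ^ a).-1 + 1).
Proof.
apply: zall_primes; first by rewrite expn_gt0.
move=> p pp; rewrite Euclid_dvdX // => /andP[]; rewrite dvdn_prime2 // => /eqP -> _.
apply: (@zall_leq _ _ _ (2 * 23 + 1)) => //.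
by apply: zall_Fp => //; apply: zall_has_line has_line_dim4.
Qed.

Lemma zall_pow2 (r a : nat) : zall (@dvdv r (2 ^ a)) (2 ^ a) (2 ^ r * (2 ^ a).-1 + 1).
Proof.
apply: zall_primes; first by rewrite expn_gt0.
move=> p pp; rewrite Euclid_dvdX // => /andP[]; rewrite dvdn_prime2 // => /eqP -> _.
rewrite muln1 -(mul1n (2 ^ r)%N); apply: zall_Fp => //.
exact: (@zall_pigeonhole 2).
Qed.

(* Splitting off subsequences of length q reduces k to a multiple of g. *)
Lemma zall_descend (V : nmodType) (Z : pred V) (q c t g k0 : nat) :
  (forall x y, Z x -> Z y -> Z (x + y)) -> (0 < g)%N ->
  zall Z q t -> zall Z (g * q) (g * q + c) -> (g %| k0)%N -> (0 < k0)%N ->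
  (t <= k0.+1 * q + c)%N ->
  forall k, (k0 <= k)%N -> zall Z (k * q) (k * q + c).
Proof.
move=> ZD g0 Zq Zg gk0 k00 tk0 k k0k; rewrite -(subnK k0k).
elim: (k - k0)%N => [|j IH].
  have /dvdnP[m mE] := gk0; rewrite add0n mE -mulnA; apply: zall_mul => //.
  by case: m mE k00 => // ->.
move=> S jS; have [|T [U [pS sT ZT]]] := Zq S.
  apply: leq_trans jS; apply: leq_trans tk0 _.
  by rewrite leq_add2r leq_mul2r addSn ltnS leq_addl orbT.
have [|T' [U' [pU sT' ZT']]] := IH U.
  by move: jS; rewrite (perm_size_cat pS) sT addSn mulSn -addnA leq_add2l.
exists (T ++ T'), U'; split.
- by rewrite (perm_trans pS) // -catA perm_cat2l.
- by rewrite size_cat sT sT' addSn mulSn.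
- by rewrite big_cat ZD.
Qed.

Lemma zall_mul_ppow (p a r b : nat) : prime p -> (r <= p ^ b)%N ->
  zall (@dvdv r (p ^ a)) (p ^ b * p ^ a) (p ^ b * p ^ a + r * p ^ a).
Proof.
move=> pp rb; rewrite -expnD addnC.
by apply: (zall_leq _ (zall_ppow pp rb)); rewrite leq_add2l leq_mul2l leq_pred orbT.
Qed.

Lemma zall_rank3 (p a k : nat) : prime p -> (6 <= k)%N ->
  zall (@dvdv 3 (p ^ a)) (k * p ^ a) (k * p ^ a + 3 * p ^ a).
Proof.
move=> pp k6; have [p5|p5] := leqP 5 p; first by apply: zall_rank3_ge5 => //; lia.
have /orP[/eqP ->|/eqP ->] : (p == 2) || (p == 3)%N.
- by move: pp p5; case: (p) => [|[|[|[|[|]]]]].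
- apply: (zall_descend _ _ (@zall_pow2 3 a) (@zall_mul_ppow 2 a 3 2 _ _) (k0 := 4)) => //.
  + by move=> x y; apply: dvdvD.
  + by have := expn_gt0 2 a; lia.
  + by lia.
(* 6 is the least multiple of 3 with 9 <= k0 + 1 + 3; this is where k >= 6 comes from. *)
apply: (zall_descend _ _ (@zall_rank3_pow3 a) (@zall_mul_ppow 3 a 3 1 _ _) (k0 := 6)) => //.
- by move=> x y; apply: dvdvD.
- by have := expn_gt0 3 a; lia.
Qed.

Lemma zall_rank4 (p a k : nat) : prime p -> (18 <= k)%N ->
  zall (@dvdv 4 (p ^ a)) (k * p ^ a) (k * p ^ a + 4 * p ^ a).
Proof.
move=> pp k18; have [p5|p5] := leqP 5 p; first by apply: zall_rank4_ge5 => //; lia.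
have /orP[/eqP ->|/eqP ->] : (p == 2) || (p == 3)%N.
- by move: pp p5; case: (p) => [|[|[|[|[|]]]]].
- apply: (zall_descend _ _ (@zall_pow2 4 a) (@zall_mul_ppow 2 a 4 2 _ _) (k0 := 12)) => //.
  + by move=> x y; apply: dvdvD.
  + by have := expn_gt0 2 a; lia.
  + by lia.
(* 18 is the least multiple of 9 with 23 <= k0 + 1 + 4; this is where k >= 18 comes from. *)
apply: (zall_descend _ _ (@zall_rank4_pow3 a) (@zall_mul_ppow 3 a 4 2 _ _) (k0 := 18)) => //.
- by move=> x y; apply: dvdvD.
- by have := expn_gt0 3 a; lia.
Qed.

(** * Largest prime power divisor *)

Lemma prime_dvd_fact (p n : nat) : prime p -> (p %| n`!)%N = (p <= n)%N.
Proof.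
move=> pp; apply/idP/idP => [|pn]; last by rewrite dvdn_fact // prime_gt0.
elim: n => [|n IH]; first by rewrite fact0 dvdn1 => /eqP p1; rewrite p1 in pp.
rewrite factS Euclid_dvdM // => /orP[/dvdn_leq-> //|/IH]; exact: leqW.
Qed.

Lemma dvdn_prod_primes (s : seq nat) (X : nat) :
  uniq s -> all prime s -> (forall p, p \in s -> p %| X)%N ->
  (\prod_(p <- s) p %| X)%N.
Proof.
elim: s => [|p s IH] /=; first by rewrite big_nil dvd1n.
move=> /andP[ps us] /andP[pp sp] sX; rewrite big_cons Gauss_dvd.
  by rewrite sX ?mem_head // IH // => q qs; rewrite sX // inE qs orbT.
rewrite prime_coprime // Euclid_dvd_prod // big_has; apply/hasPn => q qs.
rewrite dvdn_prime2 //; last exact: (allP sp).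
by apply: contraNneq ps => ->.
Qed.

(** This coefficient occurs twice in row 2m + 1 of Pascal's triangle. *)
Lemma bin_mid_le (m : nat) : ('C(2 * m + 1, m) <= 4 ^ m)%N.
Proof.
have : (2 * 'C(2 * m + 1, m) <= 2 ^ (2 * m + 1))%N.
  have -> : (2 ^ (2 * m + 1) = \sum_(i < (2 * m + 1).+1) 'C(2 * m + 1, i))%N.
    rewrite -[in LHS]addn1 -[2%N]/(1 + 1)%N expnDn.
    by apply: eq_bigr => i _; rewrite !exp1n !muln1.
  have m1 : (m < (2 * m + 1).+1)%N by lia.
  have m2 : (m.+1 < (2 * m + 1).+1)%N by lia.
  rewrite (bigD1 (Ordinal m1)) //= (bigD1 (Ordinal m2)) /=; last first.
    by apply/eqP => /(congr1 val) /=; lia.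
  rewrite addnA mul2n -addnn -[X in (_ + _ <= _ + X + _)%N]bin_sub; last by lia.
  by rewrite (_ : 2 * m + 1 - m.+1 = m)%N ?leq_addr //; lia.
by rewrite expnD expn1 [(_ * 2)%N]mulnC leq_pmul2l // expnM.
Qed.

(* Erdos's bound: the primes in ]m + 1, 2m + 1] divide 'C(2m + 1, m). *)
Lemma prod_primes_le (N : nat) (s : seq nat) :
  uniq s -> all prime s -> all (fun p => p <= N)%N s -> (\prod_(p <- s) p <= 4 ^ N)%N.
Proof.
elim/ltn_ind: N s => N IH s us ps sN.
have [N2|N2] := leqP N 2.
  have : (\prod_(p <- s) p <= 2)%N.
    apply: dvdn_leq => //; apply: dvdn_prod_primes => // p sp.
    have /prime_gt1 := allP ps p sp; have := allP sN p sp => /= pN p1.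
    by have -> : p = 2%N by lia.
  have [->|s0] := eqVneq s [::]; first by rewrite big_nil expn_gt0.
  move=> /leq_trans; apply.
  have [p sp] : exists p, p \in s.
    by case: (s) s0 => // p s' _; exists p; rewrite mem_head.
  have /prime_gt1 p1 := allP ps p sp; have := allP sN p sp => /= pN.
  by apply: (@leq_trans (4 ^ 1)) => //; rewrite leq_exp2l //; lia.
have [oN|eN] := boolP (odd N); last first.
  apply: (@leq_trans (4 ^ N.-1)); last by rewrite leq_exp2l //; lia.
  apply: IH => //; first by lia.
  apply/allP => p sp; have := allP sN p sp => /=.
  rewrite leq_eqVlt => /orP[/eqP pN|]; last by lia.
  have := allP ps p sp; rewrite pN => /even_prime[N2'|]; last by rewrite (negPf eN).
  by rewrite N2' in N2.
pose m := N./2; have Nm : N = (2 * m + 1)%N.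
  by have := odd_double_half N; rewrite oN /m; lia.
rewrite (bigID (fun p => p <= m.+1)%N) /=.
rewrite -[X in (X * _)%N]big_filter -[X in (_ * X)%N]big_filter.
have -> : (4 ^ N = 4 ^ m.+1 * 4 ^ m)%N by rewrite -expnD; congr (_ ^ _)%N; lia.
apply: leq_mul.
  apply: IH; rewrite ?filter_uniq ?filter_all //; first by lia.
  by apply/allP => p; rewrite mem_filter => /andP[_ /(allP ps)].
apply: leq_trans (bin_mid_le m); apply: dvdn_leq; first by rewrite bin_gt0; lia.
apply: dvdn_prod_primes; rewrite ?filter_uniq //.
  by apply/allP => p; rewrite mem_filter => /andP[_ /(allP ps)].
move=> p; rewrite mem_filter /= -ltnNge => /andP[mp sp].
have pp := allP ps p sp; have pN := allP sN p sp.
have := prime_dvd_fact N pp; rewrite pN -(@bin_fact N m); last by lia.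
rewrite -Nm !Euclid_dvdM // !prime_dvd_fact //.
rewrite [(p <= m)%N]leqNgt (ltn_trans _ mp) //.
by rewrite (_ : p <= N - m = false)%N ?orbF //; lia.
Qed.

Lemma sqrtn_ex (M : nat) : exists s, (s * s <= M < s.+1 * s.+1)%N.
Proof.
elim: M => [|M [s /andP[s1 s2]]]; first by exists 0%N.
have [lt|ge] := ltnP M.+1 (s.+1 * s.+1); first by exists s; rewrite lt leqW.
by exists s.+1; rewrite ge /=; nia.
Qed.

(** Primes dividing n exactly once contribute at most the product of all primes up to M, hence 4^M.
    The others are at most s, the integer part of the square root of M, and contribute at most M^s
    <= 4^(s s) <= 4^M. *)
Lemma leq_exp_ppow (n M : nat) : (0 < n)%N ->
  (forall p j, prime p -> (0 < j)%N -> p ^ j %| n -> p ^ j <= M)%N -> (n <= 16 ^ M)%N.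
Proof.
move=> n0 nM; have [s /andP[s1 s2]] := sqrtn_ex M.
have logn0 p : p \in primes n -> (0 < logn p n)%N by rewrite logn_gt0.
have pM p : p \in primes n -> (p ^ logn p n <= M)%N.
  move=> pn; apply: nM; rewrite ?logn0 ?pfactor_dvdnn //.
  by move: pn; rewrite mem_primes => /andP[].
rewrite {1}(prod_prime_decomp n0) prime_decompE big_map /=.
rewrite (bigID (fun p => logn p n == 1)%N) /=.
rewrite -[16%N]/(4 * 4)%N expnMn; apply: leq_mul.
  rewrite (eq_bigr id) => [|p /eqP ->]; last by rewrite expn1.
  rewrite -big_filter; apply: prod_primes_le; first by rewrite filter_uniq ?primes_uniq.
    by apply/allP => p; rewrite mem_filter mem_primes => /andP[_ /andP[]].
  by apply/allP => p; rewrite mem_filter => /andP[/eqP p1 /pM]; rewrite p1 expn1.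
rewrite -big_filter; set t := filter _ _.
apply: (@leq_trans (M ^ s)).
  apply: (@leq_trans (\prod_(p <- t) M)).
    rewrite big_seq [leqRHS]big_seq; apply: leq_prod => p.
    by rewrite mem_filter => /andP[_ /pM].
  rewrite big_const_seq count_predT iter_muln_1.
  have st : (size t <= s)%N.
    rewrite -(size_iota 1 s); apply: uniq_leq_size.
      by rewrite filter_uniq ?primes_uniq.
    move=> p; rewrite mem_filter /= => /andP[p1 pn]; rewrite mem_iota add1n ltnS.
    move: (pM _ pn) (logn0 _ pn) p1; rewrite mem_primes in pn; case/andP: pn => pp _.
    case: (logn p n) => [|[|j]] // pj _ _; rewrite prime_gt0 //= leqNgt; apply/negP => sp.
    have : (p ^ 2 <= p ^ j.+2)%N by rewrite leq_exp2l // prime_gt1.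
    by rewrite -mulnn; nia.
  have [M0|M0] := posnP M; last by rewrite leq_pexp2l.
  rewrite M0 in s1 *.
  have s0 : s = 0%N by case: (s) s1.
  by move: st; rewrite s0 leqn0 => /eqP ->.
have Ms : (M <= 4 ^ s)%N.
  apply: ltnW; apply: leq_trans s2 _.
  have ss : (s.+1 <= 2 ^ s)%N by apply: ltn_expl.
  by apply: leq_trans (leq_mul ss ss) _; rewrite -expnMn.
have [->|s0] := posnP s; first by rewrite expn0 expn_gt0.
apply: (@leq_trans ((4 ^ s) ^ s)); first by rewrite leq_exp2r.
by rewrite -expnM leq_exp2l.
Qed.

(** * The asymptotic formulas *)

Lemma s_inv_upper (r : nat) : exists C : nat, forall n K : nat,
  (1 < n)%N -> (0 < K)%N ->
  zall (@dvdv r (max_ppow n)) (K * max_ppow n) (K * max_ppow n + r * max_ppow n) ->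
  (s_inv (Cpow n r) (K * n) <= (K + r) * n + C * (n %/ max_ppow n))%N.
Proof.
have [C CP] := alon_dubiner r; exists C => n K n1 K0 Zq.
have [p [j [pp j0 pjn qE]]] := max_ppowP n1; rewrite -qE in pjn.
set q := max_ppow n in Zq pjn qE *; set m := (n %/ q)%N.
have q0 : (0 < q)%N by rewrite qE expn_gt0 prime_gt0.
have m0 : (0 < m)%N by rewrite divn_gt0 // dvdn_leq // ltnW.
have nE : (m * q = n)%N by rewrite divnK.
apply: s_inv_le; [by lia | by rewrite addn_gt0 muln_gt0 addn_gt0 K0; lia |].
have := zall_comp m0 (CP m m0) Zq; rewrite nE mulnCA nE.
apply: zall_leq; rewrite leq_add2r -mulnDl.
by apply: leq_trans (leq_mul (leqnn m) (leq_pred _)) _; rewrite mulnCA nE.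
Qed.

(** [M] is chosen before [K], so it depends on r only, and [K] may vary with n as p(n, r) does. The
    [r] in the constant covers the lower bound, which falls short of (K + r) n by r. *)
Lemma s_inv_bigO (R : realType) (r : nat) : exists2 M : R, 0 < M &
  forall K : nat -> nat,
  (forall n, (1 < n)%N -> (0 < K n)%N /\
     zall (@dvdv r (max_ppow n)) (K n * max_ppow n) (K n * max_ppow n + r * max_ppow n)) ->
  bigO_with M
    (fun n : nat => (s_inv (Cpow n r) (K n * n))%:R - (K n + r)%:R * n%:R)
    (fun n : nat => n%:R / ln n%:R).
Proof.
have [C CP] := s_inv_upper r.
have ln16 : 0 < ln (16 : R) by rewrite ln_gt0 // ltr1n.
exists ((C + r).+1%:R * ln 16); first by rewrite mulr_gt0.
move=> K KP; exists 2%N => // n n1; have [K0 Zq] := KP n n1.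
have [p [j [pp j0 pjn qE]]] := max_ppowP n1; rewrite -qE in pjn.
have up := CP n (K n) n1 K0 Zq; have lo := @s_inv_ge n r (K n) n1 K0.
set q := max_ppow n in up pjn qE; set m := (n %/ q)%N in up.
have q0 : (0 < q)%N by rewrite qE expn_gt0 prime_gt0.
have m0 : (0 < m)%N by rewrite divn_gt0 // dvdn_leq // ltnW.
have nE : (m * q = n)%N by rewrite divnK.
have lnn : 0 < ln (n%:R : R) by rewrite ln_gt0 // ltr1n.
have nq : ln (n%:R : R) <= q%:R * ln 16.
  rewrite mulr_natl -lnXn // ler_ln ?posrE ?ltr0n ?exprn_gt0 //; last by lia.
  rewrite -natrX ler_nat; apply: leq_exp_ppow; first by lia.
  by move=> p' j' pp' j'0; apply: max_ppow_ub; lia.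
(* From n <= 16^q, the cofactor m = n / q is at most ln 16 times n / ln n. *)
have mn : m%:R <= ln 16 * (n%:R / ln n%:R) :> R.
  rewrite mulrA ler_pdivlMr //; apply: le_trans (ler_wpM2l (ler0n _ m) nq) _.
  by rewrite mulrA -natrM nE mulrC.
rewrite [X in _ <= _ * X]ger0_norm; last by rewrite divr_ge0 ?ler0n // ltW.
apply: (@le_trans _ _ ((C + r).+1%:R * m%:R)); last by rewrite -mulrA ler_pM2l.
rewrite -natrM -natrM.
rewrite ler_norml; apply/andP; split.
  rewrite lerBrDr addrC -lerBrDr opprK -natrD ler_nat.
  by apply: leq_trans (leq_add lo (leqnn _)); move: m0; nia.
rewrite lerBlDr -natrD ler_nat; apply: leq_trans up _.
by rewrite addnC leq_add2r leq_mul2r; lia.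
Qed.

Theorem theorem1p2 (R : realType) :
  [/\ exists2 M : R, 0 < M &
        forall k : nat, (6 <= k)%N ->
          bigO_with M
            (fun n : nat => (s_inv (Cpow n 3) (k * n))%:R - (k + 3)%:R * n%:R)
            (fun n : nat => n%:R / ln n%:R),
      exists2 M : R, 0 < M &
        forall k : nat, (18 <= k)%N ->
          bigO_with M
            (fun n : nat => (s_inv (Cpow n 4) (k * n))%:R - (k + 4)%:R * n%:R)
            (fun n : nat => n%:R / ln n%:R)
    & forall r : nat, (5 <= r)%N ->
      exists2 M : R, 0 < M &
        forall k : nat, (1 <= k)%N ->
          bigO_with M
            (fun n : nat => (s_inv (Cpow n r) (k * ppow_ge n r * n))%:R
                            - (k * ppow_ge n r + r)%:R * n%:R)
            (fun n : nat => n%:R / ln n%:R)].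
Proof.
split=> [||r r5].
- have [M M0 MP] := s_inv_bigO R 3; exists M => // k k6; apply: (MP (fun=> k)) => n n1.
  have [p [a [pp _ _ ->]]] := max_ppowP n1.
  by split; [lia | apply: zall_rank3].
- have [M M0 MP] := s_inv_bigO R 4; exists M => // k k18; apply: (MP (fun=> k)) => n n1.
  have [p [a [pp _ _ ->]]] := max_ppowP n1.
  by split; [lia | apply: zall_rank4].
have [M M0 MP] := s_inv_bigO R r; exists M => // k k1.
apply: (MP (fun n => k * ppow_ge n r)%N) => n n1.
have [p [a [pp a0 _ qE]]] := max_ppowP n1.
have [[t [_ tE rt]] _] := ppow_geE r pp a0 qE; rewrite qE tE in rt *.
split; first by rewrite muln_gt0 k1 expn_gt0 prime_gt0.
rewrite -mulnA; apply: zall_mul => //; first by move=> x y; apply: dvdvD.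
exact: zall_mul_ppow.
Qed.
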